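(* Let $A$ be a unital $C^*$-algebra and $\alpha=(\{A_g\}_{g\in G},\{\alpha_g\}_{g\in G})$ a partial action of $G$ on $A$. Let $(B,G,\beta)$ be a unital partial $C^*$-dynamical system with corresponding family of central projections $\{r_g\}_{g\in G}$ and suppose that there exists a $G$-equivariant inclusion of $C^*$-algebras $A\subseteq B$ such that $B=\mathrm{Orb}_G^\beta(A)$. Suppose in addition that $r_gA_g^\perp=\{0\}$ for all $g\in G$, where $A_g^\perp=\{a\in A: aA_g=\{0\}\}$ is the annihilator of $A_g$ in $A$. Then there exists a $G$-morphism $\Psi\colon B\to\mathrm{Orb}_G^{I(\alpha)}(A)$ such that $\Psi|_A=\mathrm{id}$.
   Context: Throughout, $G$ is a discrete group with unit $e$, and ideals are closed and two-sided. A partial action of $G$ on a $C^*$-algebra $A$ is a pair $\alpha=(\{A_g\}_{g\in G},\{\alpha_g\}_{g\in G})$, where each $A_g$ is an ideal of $A$ and each $\alpha_g\colon A_{g^{-1}}\to A_g$ is a $*$-isomorphism, such that for all $g,h\in G$: (i) $A_e=A$ and $\alpha_e=\mathrm{id}$; (ii) $\alpha_g(A_{g^{-1}}\cap A_h)=A_{gh}\cap A_g$; (iii) $\alpha_g(\alpha_h(x))=\alpha_{gh}(x)$ for $x\in A_{h^{-1}}\cap A_{(gh)^{-1}}$. Then $(A,G,\alpha)$ is a partial $C^*$-dynamical system. It is unital if for every $g$ there is a central projection $p_g\in A$ with $A_g=Ap_g$ (in particular $A$ is unital). An inclusion $A\subseteq B$ is $G$-equivariant if $A_g\subseteq B_g$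 and $\beta_g$ extends $\alpha_g$ for all $g$. A $G$-morphism $\phi\colon B\to C$ between unital partial systems $(B,G,\beta)$, $(C,G,\gamma)$ with central projections $\{r_g\}$, $\{p_g\}$ is a unital completely positive (ucp) map with $\phi(r_g)=p_g$ for all $g$ and $\phi(\beta_g(x))=\gamma_g(\phi(x))$ for all $x\in B_{g^{-1}}$. $I(A)$ denotes the injective envelope of the $C^*$-algebra $A$: a unital $C^*$-algebra containing $A$, injective in the category of operator systems with ucp maps, such that the only ucp map $I(A)\to I(A)$ restricting to the identity on $A$ is the identity. For an ideal $J$ of $A$, $I(J)$ is identified with $pI(A)$, where $p$ is the (central) supremum in $I(A)$ of any increasing approximate identity of $J$. The partial action $\alpha$ extends uniquely to a unital partial action $I(\alpha)$ on $I(A)$ with $I(A)_g=I(A_g)$ and $A\subseteq I(A)$ $G$-equivariant. If $(C,G,\gamma)$ is a unital partial system with central projections $\{p_g\}$ and $A\subseteq C$ is a $G$-equivariant inclusion, then $\mathrm{Orb}^\gamma_G(A)$ is the $C^*$-subalgebra of $C$ generated by $\{\gamma_g(ap_{g^{-1}}): a\in A,\ g\in G\}$; it is $\gamma$-invariant and $\gamma$ restricts to a unital partial action on it, with ideals $p_g\mathrm{Orb}^\gamma_G(A)$. This is the partial action considered on $\mathrm{Orb}_G^{I(\alpha)}(A)$. *)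

(* Defs.v *)
From HB Require Import structures.
From mathcomp Require Import all_boot all_order all_algebra.
From mathcomp Require Import all_classical all_reals all_analysis.
From mathcomp Require Import complex.
Import Order.TTheory GRing.Theory Num.Theory.
Import numFieldNormedType.Exports.

Set Implicit Arguments.
Unset Strict Implicit.
Unset Printing Implicit Defensive.

Local Open Scope classical_set_scope.
Local Open Scope ring_scope.

(* Unital C*-algebras; the zero algebra is allowed. The product is a field of
   the mixin, and the ring structure is derived from it below, because HB has no
   join of [GRing.PzRing] and [CompleteNormedModule] and cannot add one under
   [Num.NumDomain]. *)
HB.mixin Record isCStar (R : realType) A of CompleteNormedModule R[i] A := {
  cmul : A -> A -> A ;
  cone : A ;
  star : A -> A ;
  cmulA : associative cmul ;
  cmul1x : left_id cone cmul ;
  cmulx1 : right_id cone cmul ;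
  cmulDl : left_distributive cmul +%R ;
  cmulDr : right_distributive cmul +%R ;
  cscalerAl : forall (c : R[i]) (x y : A), c *: cmul x y = cmul (c *: x) y ;
  cscalerAr : forall (c : R[i]) (x y : A), c *: cmul x y = cmul x (c *: y) ;
  cnormM : forall x y : A, `|cmul x y| <= `|x| * `|y| ;
  starK : involutive star ;
  starD : {morph star : x y / x + y} ;
  starZ : forall (c : R[i]) (x : A), star (c *: x) = c^* *: star x ;
  starM : forall x y : A, star (cmul x y) = cmul (star y) (star x) ;
  cstar_norm : forall x : A, `|cmul (star x) x| = `|x| ^+ 2
}.

#[short(type="cstarType")]
HB.structure Definition CStar (R : realType) :=
  {A of CompleteNormedModule R[i] A & isCStar R A}.

HB.instance Definition _ (R : realType) (A : cstarType R) :=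
  GRing.Zmodule_isPzRing.Build A
    (@cmulA R A) (@cmul1x R A) (@cmulx1 R A) (@cmulDl R A) (@cmulDr R A).

Definition linear_on (R : realType) (A B : cstarType R) (S : set A)
    (f : A -> B) : Prop :=
  forall (c : R[i]) (x y : A), S x -> S y -> f (c *: x + y) = c *: f x + f y.

Definition subspace (R : realType) (A : cstarType R) (S : set A) : Prop :=
  S 0 /\ (forall (c : R[i]) (x y : A), S x -> S y -> S (c *: x + y)).

Record star_hom (R : realType) (A B : cstarType R) (f : A -> B) : Prop := {
  star_hom_linear : linear_on setT f ;
  star_hom_mul : forall x y, f (x * y) = f x * f y ;
  star_hom_star : forall x, f (star x) = star (f x)
}.

(* An inclusion of C*-algebras need not preserve units. *)
Definition cstar_inclusion (R : realType) (A B : cstarType R) (f : A -> B)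
    : Prop :=
  star_hom f /\ injective f.

Record is_ideal (R : realType) (A : cstarType R) (J : set A) : Prop := {
  ideal_subspace : subspace J ;
  ideal_closed : closed J ;
  ideal_mull : forall a x, J x -> J (a * x) ;
  ideal_mulr : forall a x, J x -> J (x * a)
}.

(* C*-subalgebras need not contain the unit of the ambient algebra. *)
Record is_cstar_subalgebra (R : realType) (A : cstarType R) (S : set A)
    : Prop := {
  subalgebra_subspace : subspace S ;
  subalgebra_closed : closed S ;
  subalgebra_mul : forall x y, S x -> S y -> S (x * y) ;
  subalgebra_star : forall x, S x -> S (star x)
}.

Definition annihilator (R : realType) (A : cstarType R) (J : set A) : set A :=
  [set a | forall x, J x -> a * x = 0].

Definition central_projection (R : realType) (A : cstarType R) (p : A) : Prop :=
  [/\ star p = p, p * p = p & forall x, p * x = x * p].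

Definition cstar_ge0 (R : realType) (A : cstarType R) (x : A) : Prop :=
  exists y, x = star y * y.

Definition cstar_le (R : realType) (A : cstarType R) (x y : A) : Prop :=
  cstar_ge0 (y - x).

Definition mxstar (R : realType) (A : cstarType R) (n : nat) (X : 'M[A]_n)
    : 'M[A]_n :=
  (map_mx (@star R A) X)^T.

Definition mx_ge0 (R : realType) (A : cstarType R) (n : nat) (X : 'M[A]_n)
    : Prop :=
  exists Y : 'M[A]_n, X = mxstar Y *m Y.

(* Operator systems are represented concretely, as unital self-adjoint
   subspaces S of a unital C*-algebra A; the positive cone of M_n(S) is the one
   induced by M_n(A). *)
Record operator_system (R : realType) (A : cstarType R) (S : set A) : Prop := {
  opsys_subspace : subspace S ;
  opsys_one : S 1 ;
  opsys_star : forall x, S x -> S (star x)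
}.

(* Only the values of f on S matter. *)
Record ucp (R : realType) (A B : cstarType R) (S : set A) (T : set B)
    (f : A -> B) : Prop := {
  ucp_into : forall x, S x -> T (f x) ;
  ucp_linear : linear_on S f ;
  ucp_one : f 1 = 1 ;
  ucp_cp : forall (n : nat) (X : 'M[A]_n),
    (forall i j, S (X i j)) -> mx_ge0 X -> mx_ge0 (map_mx f X)
}.

Definition injective_opsys (R : realType) (I : cstarType R) : Prop :=
  forall (D : cstarType R) (S T : set D),
    operator_system S -> operator_system T -> S `<=` T ->
  forall f : D -> I, ucp S setT f ->
  exists2 h : D -> I, ucp T setT h & forall x, S x -> h x = f x.

(* As A is unital, the embedding of A in its injective envelope is one of
   operator systems, so it preserves the unit. *)
Record injective_envelope (R : realType) (A I : cstarType R) (iota : A -> I)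
    : Prop := {
  env_inclusion : cstar_inclusion iota ;
  env_one : iota 1 = 1 ;
  env_injective : injective_opsys I ;
  env_rigid : forall f : I -> I, ucp setT setT f ->
    (forall a, f (iota a) = iota a) -> forall x, f x = x
}.

Definition tails (L : Type) (le : L -> L -> Prop) : set_system L :=
  filter_from setT (fun l0 => [set l | le l0 l]).

Record increasing_approx_id (R : realType) (A : cstarType R) (J : set A)
    (L : Type) (le : L -> L -> Prop) (e : L -> A) : Prop := {
  aid_nonempty : inhabited L ;
  aid_refl : forall l, le l l ;
  aid_trans : forall l m n, le l m -> le m n -> le l n ;
  aid_directed : forall l m, exists n, le l n /\ le m n ;
  aid_in : forall l, J (e l) ;
  aid_ge0 : forall l, cstar_ge0 (e l) ;
  aid_norm : forall l, `|e l| <= 1 ;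
  aid_mono : forall l m, le l m -> cstar_le (e l) (e m) ;
  aid_cvgl : forall a, J a -> e l * a @[l --> tails le] --> a ;
  aid_cvgr : forall a, J a -> a * e l @[l --> tails le] --> a
}.

Definition cstar_sup (R : realType) (A : cstarType R) (E : set A) (p : A)
    : Prop :=
  [/\ star p = p, forall x, E x -> cstar_le x p &
    forall y, star y = y -> (forall x, E x -> cstar_le x y) -> cstar_le p y].

(* p is the supremum in I of an increasing approximate identity of J, so that
   p I is the copy of I(J) inside I. This supremum does not depend on the
   approximate identity, whence the existential quantifier. *)
Definition ideal_support (R : realType) (A I : cstarType R) (iota : A -> I)
    (J : set A) (p : I) : Prop :=
  exists (L : Type) (le : L -> L -> Prop) (e : L -> A),
    increasing_approx_id J le e /\ cstar_sup (range (iota \o e)) p.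

(* alpha g is a total function of which only the restriction to Ag g^-1 is
   meaningful. *)
Record partial_action (R : realType) (G : groupType) (A : cstarType R)
    (Ag : G -> set A) (alpha : G -> A -> A) : Prop := {
  pact_ideal : forall g, is_ideal (Ag g) ;
  pact_bij : forall g, set_bij (Ag g^-1%g) (Ag g) (alpha g) ;
  pact_linear : forall g, linear_on (Ag g^-1%g) (alpha g) ;
  pact_mul : forall g x y, Ag g^-1%g x -> Ag g^-1%g y ->
    alpha g (x * y) = alpha g x * alpha g y ;
  pact_star : forall g x, Ag g^-1%g x -> alpha g (star x) = star (alpha g x) ;
  pact_dom1 : Ag 1%g = setT ;
  pact_1 : forall x, alpha 1%g x = x ;
  pact_image : forall g h,
    alpha g @` (Ag g^-1%g `&` Ag h) = Ag (g * h)%g `&` Ag g ;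
  pact_comp : forall g h x, Ag h^-1%g x -> Ag (g * h)^-1%g x ->
    alpha g (alpha h x) = alpha (g * h)%g x
}.

Definition unital_partial_action (R : realType) (G : groupType)
    (A : cstarType R) (Ag : G -> set A) (alpha : G -> A -> A) (p : G -> A)
    : Prop :=
  partial_action Ag alpha /\
  (forall g, central_projection (p g) /\ Ag g = [set a * p g | a in setT]).

Definition equivariant_inclusion (R : realType) (G : groupType)
    (A B : cstarType R) (Ag : G -> set A) (alpha : G -> A -> A)
    (Bg : G -> set B) (beta : G -> B -> B) (iota : A -> B) : Prop :=
  [/\ cstar_inclusion iota,
      forall g, iota @` Ag g `<=` Bg g &
      forall g a, Ag g^-1%g a -> beta g (iota a) = iota (alpha g a)].

(* (Ig, gamma) is the partial action I(alpha) on the injective envelope I. *)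
Definition envelope_action (R : realType) (G : groupType) (A I : cstarType R)
    (Ag : G -> set A) (alpha : G -> A -> A) (iota : A -> I)
    (Ig : G -> set I) (gamma : G -> I -> I) (p : G -> I) : Prop :=
  [/\ unital_partial_action Ig gamma p,
      forall g, ideal_support iota (Ag g) (p g) &
      equivariant_inclusion Ag alpha Ig gamma iota].

Definition Orb (R : realType) (G : groupType) (A C : cstarType R)
    (iota : A -> C) (gamma : G -> C -> C) (p : G -> C) : set C :=
  smallest (@is_cstar_subalgebra R C)
    [set x | exists (a : A) (g : G), x = gamma g (iota a * p g^-1%g)].

(* G-morphisms from (B, G, beta) to the partial system obtained by restricting
   (C, G, gamma) to a gamma-invariant C*-subalgebra S that contains 1 and the
   projections p g; the ideals of the latter are p g * S. *)
Record G_morphism (R : realType) (G : groupType) (B C : cstarType R)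
    (Bg : G -> set B) (beta : G -> B -> B) (r : G -> B)
    (S : set C) (gamma : G -> C -> C) (p : G -> C) (phi : B -> C) : Prop := {
  gmor_ucp : ucp setT S phi ;
  gmor_proj : forall g, phi (r g) = p g ;
  gmor_equiv : forall g x, Bg g^-1%g x -> phi (beta g x) = gamma g (phi x)
}.

(* Main.v *)
(* By injectivity of I(A), the identity of A extends to a ucp map phi : B -> I(A),
   and A lies in the multiplicative domain of phi. Since A_g + A_g^perp is
   essential in A, an element of I(A) killed by A_g and A_g^perp vanishes: the map
   A + C z -> A, a + c z |-> a, is ucp, so by rigidity it is the restriction of
   the identity. Both phi(r_g) and p_g act as the identity on A_g and are killed by
   A_g^perp (for phi(r_g) because r_g A_g^perp = 0), so phi(r_g) = p_g. Multiplying
   by elements of A_g then yields phi(beta_g(a r_g^-1)) = gamma_g(a p_g^-1), so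
   these generators of B also lie in the multiplicative domain; hence phi is a
   *-homomorphism, it maps B into Orb(A), and it is equivariant. *)
Require Import Defs.
From HB Require Import structures.
From mathcomp Require Import all_boot all_order all_algebra.
From mathcomp Require Import all_classical all_reals all_analysis.
From mathcomp Require Import complex ring lra.
Import Order.TTheory GRing.Theory Num.Theory.
Import numFieldNormedType.Exports.

Set Implicit Arguments.
Unset Strict Implicit.
Unset Printing Implicit Defensive.
Local Open Scope classical_set_scope.
Local Open Scope ring_scope.

(** * Real-valued norm and scalars of a C*-algebra *)

(** Order arguments in C*-algebras and in their matrix algebras carry the proof; they are derived
    from the C*-axioms alone, without spectra, functional calculus or representations. The one
    analytic tool is a square root obtained from polynomials with nonnegative coefficients, which
    makes sense in any Banach ring. This generality matters for M_n(A), which is never given a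
    C*-norm: in the sum of the entry norms an element between 0 and 1 may have norm above 1, but its
    powers stay bounded. Hence [banach_sqrt] asks only for bounded powers, and positivity of
    matrices is tested on an A-valued quadratic form. A second obstacle is that A may sit in B with
    a different unit, so that the identity of A is not directly a ucp map on an operator system in
    B. In [envelope_extension] the operator system consists of the elements that act on a set E like
    an element of A, whence 1 and the unit of A are both sent to 1. With E all of A this yields phi;
    with E the union of A_g and its annihilator, inside I(A), it yields the vanishing criterion. *)

Lemma le_eps (R : realType) (x y : R) :
  (forall e : R, 0 < e -> x <= y + e) -> x <= y.
Proof. by move=> h; apply/ler_addgt0Pr. Qed.

Section RealNorm.
Variables (R : realType) (A : cstarType R).
Implicit Types (x y z : A) (a b : R) (c : R[i]).

(* Scalars are handled as central elements of the ring A, which is not declared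
   as an algebra over R[i]. *)
Definition csc c : A := c *: (1 : A).
Definition rsc a : A := csc (a%:C)%C.
(* `|x| lives in R[i]; nm x is the same number in R. *)
Definition nm x : R := complex.Re `|x|.

Lemma cscE c x : c *: x = csc c * x.
Proof.
have -> : csc c * x = c *: (1 * x) by symmetry; exact: cscalerAl.
by rewrite mul1r.
Qed.

Lemma csc_comm c x : csc c * x = x * csc c.
Proof.
have -> : x * csc c = c *: (x * 1) by symmetry; exact: cscalerAr.
by rewrite mulr1 cscE.
Qed.

Lemma cscD : {morph csc : c d / c + d}.
Proof. by move=> c d; rewrite /csc scalerDl. Qed.

Lemma cscM : {morph csc : c d / c * d}.
Proof. by move=> c d; rewrite /csc -scalerA -/(csc d) cscE. Qed.

Lemma csc1 : csc 1 = 1. Proof. by rewrite /csc scale1r. Qed.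
Lemma csc0 : csc 0 = 0. Proof. by rewrite /csc scale0r. Qed.
Lemma cscN c : csc (- c) = - csc c. Proof. by rewrite /csc scaleNr. Qed.

Lemma rscD : {morph rsc : a b / a + b}.
Proof. by move=> a b; rewrite /rsc rmorphD cscD. Qed.
Lemma rscM : {morph rsc : a b / a * b}.
Proof. by move=> a b; rewrite /rsc rmorphM cscM. Qed.
Lemma rsc1 : rsc 1 = 1. Proof. by rewrite /rsc rmorph1 csc1. Qed.
Lemma rsc0 : rsc 0 = 0. Proof. by rewrite /rsc rmorph0 csc0. Qed.
Lemma rscN a : rsc (- a) = - rsc a. Proof. by rewrite /rsc rmorphN cscN. Qed.
Lemma rsc_comm a x : rsc a * x = x * rsc a. Proof. exact: csc_comm. Qed.
Lemma rscV a x : a != 0 -> rsc a^-1 * (rsc a * x) = x.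
Proof. by move=> a0; rewrite mulrA -rscM mulVf // rsc1 mul1r. Qed.

Lemma csc_mulCA c x y : x * (csc c * y) = csc c * (x * y).
Proof. by rewrite !mulrA csc_comm. Qed.
Lemma rsc_mulCA a x y : x * (rsc a * y) = rsc a * (x * y).
Proof. by rewrite !mulrA rsc_comm. Qed.
Lemma rscMl a b x : rsc a * (rsc b * x) = rsc (a * b) * x.
Proof. by rewrite mulrA -rscM. Qed.
Lemma rscMM a b x y : rsc a * x * (rsc b * y) = rsc (a * b) * (x * y).
Proof. by rewrite -mulrA rsc_mulCA mulrA -rscM. Qed.

Lemma nmE x : `|x| = ((nm x)%:C)%C.
Proof. by rewrite /nm RRe_real // normr_real. Qed.

Lemma nm_ge0 x : 0 <= nm x.
Proof. by rewrite -ler0c -nmE. Qed.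

Lemma nm0 : nm 0 = 0.
Proof. by apply: complexI; rewrite -nmE normr0. Qed.

Lemma nm_eq0 x : nm x = 0 -> x = 0.
Proof. by move=> h; apply/eqP; rewrite -normr_eq0 nmE h. Qed.

Lemma nmN x : nm (- x) = nm x.
Proof. by rewrite /nm normrN. Qed.

Lemma nmD x y : nm (x + y) <= nm x + nm y.
Proof. by rewrite -lecR rmorphD /= -!nmE ler_normD. Qed.

Lemma nmB x y : nm (x - y) <= nm x + nm y.
Proof. by rewrite -[nm y]nmN nmD. Qed.

Lemma nm_sym x y : nm (x - y) = nm (y - x).
Proof. by rewrite -nmN opprB. Qed.

Lemma nmM x y : nm (x * y) <= nm x * nm y.
Proof. by rewrite -lecR rmorphM /= -!nmE; exact: cnormM. Qed.

Lemma nmC x : nm (star x * x) = nm x ^+ 2.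
Proof. by apply: complexI; rewrite rmorphXn /= -!nmE; exact: cstar_norm. Qed.

Lemma nm_rsc a x : nm (rsc a * x) = `|a| * nm x.
Proof.
apply: complexI; rewrite -nmE /rsc -cscE normrZ rmorphM /= nmE; congr (_ * _).
by rewrite normc_def /= expr0n /= addr0 sqrtr_sqr.
Qed.

Lemma star0 : star (0 : A) = 0.
Proof. by apply: (addrI (star 0)); rewrite -starD !addr0. Qed.

Lemma starN x : star (- x) = - star x.
Proof. by apply: (addrI (star x)); rewrite -starD !subrr star0. Qed.

Lemma starB x y : star (x - y) = star x - star y.
Proof. by rewrite starD starN. Qed.

Lemma star_mul x y : star (x * y) = star y * star x.
Proof. exact: starM. Qed.

Lemma star1 : star (1 : A) = 1.
Proof. by rewrite -[LHS]mulr1 -{2}(starK 1) -star_mul mulr1 starK. Qed.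

Lemma star_csc c : star (csc c) = csc (c^*)%R.
Proof. by rewrite /csc starZ star1. Qed.

Lemma star_rsc a : star (rsc a) = rsc a.
Proof.
rewrite /rsc star_csc conj_Creal //.
by apply/complex_realP; exists a.
Qed.

Lemma nm_star x : nm (star x) = nm x.
Proof.
have h y : nm y <= nm (star y).
  have [->|y0] := eqVneq (nm y) 0; first exact: nm_ge0.
  have y1 : 0 < nm y by rewrite lt_neqAle eq_sym y0 nm_ge0.
  by rewrite -(ler_pM2r y1) -expr2 -nmC nmM.
by apply/le_anti; rewrite h -{2}(starK x) h.
Qed.

Lemma nm1 : nm 1 <= 1.
Proof.
have := nmC 1; rewrite star1 mulr1 => h.
have := nm_ge0 1; nra.
Qed.

Lemma nm_rsc1 a : 0 <= a -> nm (rsc a) <= a.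
Proof.
move=> a0; rewrite -[rsc a]mulr1 nm_rsc ger0_norm //.
have := nm1; have := nm_ge0 1; nra.
Qed.

Lemma nm_small x : (forall e : R, 0 < e -> nm x <= e) -> x = 0.
Proof.
move=> h; apply: nm_eq0; apply/le_anti; rewrite nm_ge0 andbT.
by apply: le_eps => e e0; rewrite add0r h.
Qed.

(** The rate [C / m.+1] is the one at which the square root iteration converges; keeping it explicit
    lets later estimates be plain inequalities. *)
Lemma nm_cauchy (u : nat -> A) (C : R) :
  (forall m k, nm (u (m + k)%N - u m) <= C / m.+1%:R) ->
  exists l, forall m, nm (l - u m) <= C / m.+1%:R.
Proof.
move=> hu.
have C0 : 0 <= C by have := hu 0 0; rewrite addn0 subrr nm0 divr1.
have hC (e : R) : 0 < e -> exists N : nat, C / N.+1%:R < e.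
  move=> e0; have [N hN] : exists N : nat, C / e < N%:R.
    by exists (Num.bound (C / e)); apply: archi_boundP; rewrite divr_ge0 // ltW.
  exists N; rewrite ltr_pdivrMr ?ltr0n // mulrC -ltr_pdivrMr //.
  by rewrite (lt_trans hN) // ltr_nat.
have hcv : cvg (u @ \oo).
  apply: cauchy_cvg; apply/cauchy_exP => eps eps0.
  have epsR : (complex.Re eps)%:C%C = eps.
    by rewrite RRe_real // ger0_real // ltW.
  have [|N hN] := hC (complex.Re eps); first by rewrite -ltcR epsR.
  exists (u N), N => //= n /= Nn.
  rewrite -ball_normE /= nmE -epsR ltcR nm_sym.
  by rewrite -(subnKC Nn) (le_lt_trans (hu _ _)).
pose l : A := lim (u @ \oo).
have {hcv} : u @ \oo --> l := hcv.
move: l => l hcv; exists l => m.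
apply: le_eps => e e0.
have := (@cvgrPdist_lt _ A _ _ eventually_filter u l).1 hcv (e%:C)%C.
rewrite ltcR => /(_ e0).
case=> N _ /(_ (N + m)%N) /=; rewrite leq_addr => /(_ isT).
rewrite nmE ltcR => h.
have := hu m N; rewrite [(m + N)%N]addnC => h'.
have := nmD (l - u (N + m)%N) (u (N + m)%N - u m).
rewrite addrA subrK; move: h'; set q := C / _; move: h; clear; lra.
Qed.

Lemma closed_nm (S : set A) x : closed S ->
  (forall e : R, 0 < e -> exists2 y, S y & nm (x - y) <= e) -> S x.
Proof.
move=> cS h; apply: cS => U /nbhs_ballP[eps /= eps0 hU].
have epsR : (complex.Re eps)%:C%C = eps.
  by rewrite RRe_real // ger0_real // ltW.
have e0 : 0 < complex.Re eps by rewrite -ltcR epsR.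
have [|y Sy hy] := h (complex.Re eps / 2); first by rewrite divr_gt0.
exists y; split => //; apply: hU; rewrite -ball_normE /= nmE -epsR ltcR.
by apply: (le_lt_trans hy); lra.
Qed.

Lemma nm_closed (S : set A) :
  (forall x, (forall e : R, 0 < e -> exists2 y, S y & nm (x - y) <= e) -> S x) ->
  closed S.
Proof.
move=> h x clx; apply: h => e e0.
have /clx[y [Sy]] : nbhs x (ball x (e%:C)%C).
  by apply: nbhsx_ballx; rewrite ltcR.
rewrite -ball_normE /= nmE ltcR => hy; exists y => //; exact: ltW.
Qed.
End RealNorm.
Arguments csc {R} A c.
Arguments rsc {R} A a.

(** * Square roots in Banach algebras *)

Lemma le0_inv_nat (R : realType) (x C : R) :
  (forall m : nat, x <= C / m.+1%:R) -> x <= 0.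
Proof.
move=> hx; rewrite leNgt; apply/negP => x0.
have C0 : 0 < C by apply: lt_le_trans x0 _; rewrite -[C]divr1 (hx 0%N).
have h := archi_boundP (ltW (divr_gt0 C0 x0)).
have := hx (Num.bound (C / x)); rewrite ler_pdivlMr ?ltr0n // leNgt => /negP; apply.
rewrite mulrC -ltr_pdivrMr // (lt_le_trans h) // ler_nat; exact: leqnSn.
Qed.

(** Shared by A with [nm] and by M_n(A) with the sum of the entry norms; [k] embeds the real scalars
    centrally. [N 1] may exceed 1, as it does for matrices. *)
Record banach_ring (R : realType) (V : pzRingType) (N : V -> R) (k : R -> V)
    : Prop := {
  br_eq0 : forall x, N x = 0 -> x = 0 ;
  br_add : forall x y, N (x + y) <= N x + N y ;
  br_opp : forall x, N (- x) = N x ;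
  br_mul : forall x y, N (x * y) <= N x * N y ;
  br_kD : {morph k : a b / a + b} ;
  br_kM : {morph k : a b / a * b} ;
  br_k1 : k 1 = 1 ;
  br_kC : forall a x, k a * x = x * k a ;
  br_scale : forall a x, N (k a * x) <= `|a| * N x ;
  br_complete : forall (u : nat -> V) (C : R),
    (forall m j, N (u (m + j)%N - u m) <= C / m.+1%:R) ->
    exists l, forall m, N (l - u m) <= C / m.+1%:R
}.

Section SquareRoot.
Variables (R : realType) (V : pzRingType) (N : V -> R) (k : R -> V).
Hypothesis br : banach_ring N k.

Let N0 : N 0 = 0.
Proof.
apply/le_anti/andP; split.
  have := br_scale br 0 0.
  by rewrite mulr0 normr0 mul0r.
have := br_add br 0 (- 0); rewrite (br_opp br) subr0; lra.
Qed.

Let N_ge0 x : 0 <= N x.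
Proof. by have := br_add br x (- x); rewrite (br_opp br) subrr N0; lra. Qed.

(* Combinations of powers of T with nonnegative coefficients of sum c. *)
Inductive pos_comb (T : V) : R -> V -> Prop :=
| PosComb0 : pos_comb T 0 0
| PosCombS i a c Q : 0 <= a -> pos_comb T c Q ->
    pos_comb T (a + c) (k a * T ^+ i + Q).

Lemma pos_comb_add T c Q c' Q' :
  pos_comb T c Q -> pos_comb T c' Q' -> pos_comb T (c + c') (Q + Q').
Proof.
move=> h h'; elim: h => [|i a d P a0 _ IH]; first by rewrite !add0r.
by rewrite -!addrA; constructor.
Qed.

Lemma pos_comb_mono T i a c Q :
  0 <= a -> pos_comb T c Q -> pos_comb T (a * c) (k a * T ^+ i * Q).
Proof.
move=> a0; elim=> [|j b d P b0 _ IH]; first by rewrite !mulr0; constructor.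
rewrite !mulrDr; have -> : k a * T ^+ i * (k b * T ^+ j) = k (a * b) * T ^+ (i + j).
  by rewrite (br_kM br) exprD !mulrA; congr (_ * _); rewrite -!mulrA -(br_kC br).
by constructor => //; exact: mulr_ge0.
Qed.

Lemma pos_comb_mul T c Q c' Q' :
  pos_comb T c Q -> pos_comb T c' Q' -> pos_comb T (c * c') (Q * Q').
Proof.
move=> h h'; elim: h => [|i a d P a0 _ IH]; first by rewrite !mul0r; constructor.
by rewrite !mulrDl; apply: pos_comb_add => //; exact: pos_comb_mono.
Qed.

Lemma pos_comb_exp T i : pos_comb T 1 (T ^+ i).
Proof.
have := PosCombS i (@ler01 R) (PosComb0 T).
by rewrite !addr0 (br_k1 br) mul1r.
Qed.

Lemma pos_comb_scale T a c Q :
  0 <= a -> pos_comb T c Q -> pos_comb T (a * c) (k a * Q).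
Proof. by move=> a0 /(pos_comb_mono 0 a0); rewrite expr0 mulr1. Qed.

Lemma pos_comb_norm T c Q K : (forall i, N (T ^+ i) <= K) ->
  pos_comb T c Q -> N Q <= c * K.
Proof.
move=> hT; elim=> [|i a d P a0 _ IH]; first by rewrite N0 mul0r.
rewrite (le_trans (br_add br _ _)) // mulrDl lerD //.
by rewrite (le_trans (br_scale br _ _)) // ger0_norm // ler_wpM2l.
Qed.

Lemma pos_comb_comm T c Q W : W * T = T * W -> pos_comb T c Q -> W * Q = Q * W.
Proof.
move=> WT; elim=> [|i a d P _ _ IH]; first by rewrite mulr0 mul0r.
have WTi : W * T ^+ i = T ^+ i * W by exact: commrX.
by rewrite mulrDr mulrDl IH mulrA -(br_kC br) -!mulrA WTi.
Qed.

(** [st] will be [star] or the conjugate transpose [ctr]. *)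
Lemma pos_comb_fix T c Q (st : V -> V) :
  {morph st : x y / x + y} -> (forall x y, st (x * y) = st y * st x) ->
  st 1 = 1 -> (forall a, st (k a) = k a) -> st T = T ->
  pos_comb T c Q -> st Q = Q.
Proof.
move=> stD stM st1 stk stT; elim=> [|i a d P _ _ IH].
  by apply: (addrI (st 0)); rewrite -stD !addr0.
have stTi : st (T ^+ i) = T ^+ i.
  by elim: i => [|i IHi]; rewrite ?expr0 // exprS stM IHi stT -exprSr -exprS.
by rewrite stD stM stTi stk IH (br_kC br).
Qed.

Let half : R := 2^-1.
Fixpoint sqrt_iter (T : V) m : V :=
  if m is m'.+1 then k half * (T + sqrt_iter T m' ^+ 2) else 0.
(** The iteration at T = 1, that is, the sum of the coefficients of [sqrt_iter T m] as a polynomial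
    in T; it increases to 1. *)
Fixpoint sqrt_weight m : R :=
  if m is m'.+1 then half * (1 + sqrt_weight m' ^+ 2) else 0.

(** For u = 1 - w the recursion reads u' = u - u^2 / 2, which increases with u on [0, 1]. Inserting
    u = 2 / q gives 2 (q - 1) / q^2 <= 2 / (q + 1), legitimate once q >= 2; before that u' <= 1 / 2
    suffices. *)
Lemma sqrt_weight_bound m :
  0 <= sqrt_weight m <= 1 /\ 1 - sqrt_weight m <= 2 / m.+1%:R.
Proof.
elim: m => [|m [/andP[w0 w1] IH]] /=; first by rewrite lexx ler01; split=> //; lra.
set w := sqrt_weight m in w0 w1 IH *.
have h2 : half * 2 = 1 :> R by rewrite /half; field.
split; first by apply/andP; split; nra.
rewrite -[m.+2]addn1 natrD mulr1n; set q : R := m.+1%:R in IH *.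
have q1 : 1 <= q by rewrite /q ler1n.
rewrite ler_pdivlMr; last by lra.
move: IH; rewrite ler_pdivlMr; last by lra.
move=> IH; have -> : 1 - half * (1 + w ^+ 2) = (1 - w) * (1 + w) / 2.
  by rewrite /half; field.
case: (lerP q 2) => hq; first nra.
nra.
Qed.

Lemma pos_comb_iter T m : pos_comb T (sqrt_weight m) (sqrt_iter T m).
Proof.
elim: m => [|m IH] /=; first exact: PosComb0.
apply: pos_comb_scale; first by rewrite /half; lra.
by apply: pos_comb_add; [exact: (pos_comb_exp T 1)|exact: pos_comb_mul].
Qed.

(** The iterates commute, so S_(m+2) - S_(m+1) = (S_(m+1) - S_m) (S_(m+1) + S_m) / 2 and nonnegative
    coefficients propagate. Increments in V are thereby controlled by the increments of the scalar
    weights. *)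
Lemma pos_comb_step T m : pos_comb T (sqrt_weight m.+1 - sqrt_weight m)
  (sqrt_iter T m.+1 - sqrt_iter T m).
Proof.
elim: m => [|m IH]; first by rewrite /= !subr0; exact: (pos_comb_iter T 1).
have -> : sqrt_weight m.+2 - sqrt_weight m.+1 =
    half * ((sqrt_weight m.+1 - sqrt_weight m) *
            (sqrt_weight m.+1 + sqrt_weight m)).
  by rewrite [sqrt_weight m.+2]/= -/(sqrt_weight m.+1) /=; ring.
have comm : sqrt_iter T m * sqrt_iter T m.+1 = sqrt_iter T m.+1 * sqrt_iter T m.
  apply: (pos_comb_comm _ (pos_comb_iter T m.+1)).
  by symmetry; apply: (pos_comb_comm _ (pos_comb_iter T m)).
have -> : sqrt_iter T m.+2 - sqrt_iter T m.+1 =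
    k half * ((sqrt_iter T m.+1 - sqrt_iter T m) *
              (sqrt_iter T m.+1 + sqrt_iter T m)).
  have -> : (sqrt_iter T m.+1 - sqrt_iter T m) *
              (sqrt_iter T m.+1 + sqrt_iter T m) =
            sqrt_iter T m.+1 ^+ 2 - sqrt_iter T m ^+ 2.
    rewrite mulrDr !mulrBl comm addrA -!expr2; congr (_ - _).
    by rewrite subrK.
  have e j : sqrt_iter T j.+1 = k half * (T + sqrt_iter T j ^+ 2) by [].
  by rewrite e (e m) -mulrBr opprD addrACA subrr add0r.
apply: pos_comb_scale; first by rewrite /half; lra.
by apply: pos_comb_mul => //; apply: pos_comb_add; exact: pos_comb_iter.
Qed.

Lemma pos_comb_steps T m j : pos_comb T
  (sqrt_weight (m + j) - sqrt_weight m) (sqrt_iter T (m + j) - sqrt_iter T m).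
Proof.
elim: j => [|j IH]; first by rewrite addn0 !subrr; exact: PosComb0.
rewrite addnS -[X in pos_comb _ X](subrKA (sqrt_weight (m + j))).
rewrite -[X in pos_comb _ _ X](subrKA (sqrt_iter T (m + j))).
by apply: pos_comb_add => //; exact: pos_comb_step.
Qed.

(* The iteration S_(m+1) = (T + S_m ^+ 2) / 2 converges to 1 - sqrt (1 - T). *)
Theorem banach_sqrt T K : (forall i, N (T ^+ i) <= K) ->
  exists S, [/\ (1 - S) ^+ 2 = 1 - T, N S <= K,
    forall W, W * T = T * W -> W * S = S * W &
    forall st : V -> V,
      {morph st : x y / x + y} -> (forall x y, st (x * y) = st y * st x) ->
      st 1 = 1 -> (forall a, st (k a) = k a) -> (forall x, N (st x) = N x) ->
      st T = T -> st S = S].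
Proof.
move=> hT.
have K0 : 0 <= K by apply: le_trans (hT 0%N).
have [|S hS] := br_complete br (u := sqrt_iter T) (C := 2 * K).
  move=> m j; apply: (le_trans (pos_comb_norm hT (pos_comb_steps T m j))).
  rewrite -mulrAC ler_wpM2r //.
  have [_ h1] := sqrt_weight_bound m.
  have [/andP[_ h2] _] := sqrt_weight_bound (m + j).
  by apply: le_trans h1; rewrite lerD2r.
have small x C : (forall m : nat, N x <= C / m.+1%:R) -> x = 0.
  by move=> /le0_inv_nat x0; apply: (br_eq0 br); apply/le_anti; rewrite x0 N_ge0.
have hP m : N (sqrt_iter T m) <= K.
  apply: (le_trans (pos_comb_norm hT (pos_comb_iter T m))).
  have [/andP[_ h] _] := sqrt_weight_bound m; exact: ler_piMl.
have hSK : N S <= K.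
  suff : N S - K <= 0 by rewrite subr_le0.
  apply: (@le0_inv_nat _ _ (2 * K)) => m; apply: le_trans (hS m).
  rewrite lerBlDr; apply: (le_trans _ (lerD (lexx _) (hP m))).
  by rewrite -{1}[S](subrK (sqrt_iter T m)) (br_add br).
have N_sub x y : N (x - y) = N (y - x) by rewrite -(br_opp br) opprB.
exists S; split => //.
- have Seq : S = k half * (T + S ^+ 2).
    apply/eqP; rewrite -subr_eq0; apply/eqP.
    (* 2K comes from S - S_(m+1); 2K * K is half the sum of the two terms of S_m^2 - S^2, each at
       most K * (2K / (m + 1)). *)
    apply: (small _ (2 * K + 2 * K * K)) => m.
    rewrite -(subrKA (sqrt_iter T m.+1)).
    have -> : sqrt_iter T m.+1 - k half * (T + S ^+ 2) =
        k half * (sqrt_iter T m * (sqrt_iter T m - S) +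
                  (sqrt_iter T m - S) * S).
      rewrite /= -mulrBr opprD addrACA subrr add0r; congr (_ * _).
      by rewrite mulrBr mulrBl addrA subrK.
    apply: (le_trans (br_add br _ _)).
    rewrite [X in _ <= X]mulrDl; apply: lerD.
      apply: le_trans (hS m.+1) _; rewrite ler_wpM2l ?mulr_ge0 //.
      by rewrite lef_pV2 ?posrE ?ltr0n // ler_nat.
    apply: (le_trans (br_scale br _ _)); rewrite ger0_norm; last by rewrite /half; lra.
    have h := hS m; rewrite -N_sub in h.
    have h1 : N (sqrt_iter T m * (sqrt_iter T m - S)) <= K * (2 * K / m.+1%:R).
      by apply: le_trans (br_mul br _ _) _; apply: ler_pM.
    have h2 : N ((sqrt_iter T m - S) * S) <= K * (2 * K / m.+1%:R).
      by apply: le_trans (br_mul br _ _) _; rewrite mulrC; apply: ler_pM.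
    have h3 := br_add br (sqrt_iter T m * (sqrt_iter T m - S))
                 ((sqrt_iter T m - S) * S).
    have -> : 2 * K * K / m.+1%:R = K * (2 * K / m.+1%:R) by ring.
    move: h1 h2 h3; set q := K * (_ / _); rewrite /half; clear; lra.
  have e : T + S ^+ 2 = S *+ 2.
    have k2 : k 2 * k half = 1.
      by rewrite -(br_kM br) /half divff ?pnatr_eq0 // (br_k1 br).
    have -> : S *+ 2 = k 2 * S by rewrite (br_kD br 1 1) (br_k1 br) mulrDl mul1r mulr2n.
    by rewrite {2}Seq mulrA k2 mul1r.
  have -> : T = S *+ 2 - S ^+ 2 by rewrite -e addrK.
  rewrite expr2 mulrBl mul1r mulrBr mulr1 -expr2 mulr2n.
  by rewrite !opprB !opprD !addrA [1 - S + _]addrAC.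
- move=> W WT; apply/eqP; rewrite -subr_eq0; apply/eqP.
  apply: (small _ (N W * (2 * K) * 2)) => m.
  have -> : W * S - S * W =
      W * (S - sqrt_iter T m) - (S - sqrt_iter T m) * W.
    rewrite mulrBr mulrBl (pos_comb_comm WT (pos_comb_iter T m)).
    by rewrite opprB addrA subrK.
  apply: (le_trans (br_add br _ _)); rewrite (br_opp br).
  have h1 : N (W * (S - sqrt_iter T m)) <= N W * (2 * K / m.+1%:R).
    by apply: le_trans (br_mul br _ _) _; apply: ler_pM.
  have h2 : N ((S - sqrt_iter T m) * W) <= N W * (2 * K / m.+1%:R).
    by apply: le_trans (br_mul br _ _) _; rewrite mulrC; apply: ler_pM.
  have -> : N W * (2 * K) * 2 / m.+1%:R = N W * (2 * K / m.+1%:R) * 2 by ring.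
  by move: h1 h2; set q := N W * (_ / _); clear; lra.
- move=> st stD stM st1 stk stN stT; apply/eqP; rewrite -subr_eq0; apply/eqP.
  apply: (small _ (2 * K * 2)) => m.
  have fixP := pos_comb_fix stD stM st1 stk stT (pos_comb_iter T m).
  have stN' x : st (- x) = - st x.
    apply: (addrI (st x)); rewrite -stD !subrr.
    by apply: (addrI (st 0)); rewrite -stD !addr0.
  have -> : st S - S = st (S - sqrt_iter T m) - (S - sqrt_iter T m).
    by rewrite stD stN' fixP opprB addrA subrK.
  apply: (le_trans (br_add br _ _)); rewrite (br_opp br) stN.
  have -> : 2 * K * 2 / m.+1%:R = 2 * K / m.+1%:R * 2 by ring.
  by have := hS m; set q := _ / _; clear; lra.
Qed.
End SquareRoot.

(** * Positive elements *)

Lemma sqrD_sub_sqrB (V : pzRingType) (y z : V) :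
  (y + z) * (y + z) - (y - z) * (y - z) = (y * z + z * y) *+ 2.
Proof.
have -> : (y + z) * (y + z) = y * y + z * z + (y * z + z * y).
  by rewrite mulrDl !mulrDr [z * y + _]addrC addrACA.
have -> : (y - z) * (y - z) = y * y + z * z - (y * z + z * y).
  by rewrite mulrBl !mulrBr opprB addrACA -opprD.
by rewrite opprB [y * y + _ + _]addrC addrACA subrr addr0 mulr2n.
Qed.

Lemma cstar_banach_ring (R : realType) (A : cstarType R) :
  banach_ring (@nm R A) (rsc A).
Proof.
split; [exact: nm_eq0|exact: nmD|exact: nmN|exact: nmM|exact: rscD|exact: rscM
  |exact: rsc1|exact: rsc_comm|by move=> a x; rewrite nm_rsc|exact: nm_cauchy].
Qed.

Section Positive.
Variables (R : realType) (A : cstarType R).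
Implicit Types (a b s v w x y z : A) (t : R).

(* Equivalent to cstar_ge0, see cstar_ge0P; sums of positive elements are
   obviously positive with this definition. *)
Definition pos x := star x = x /\ exists t, nm (rsc A t - x) <= t.

Lemma posD x y : pos x -> pos y -> pos (x + y).
Proof.
move=> [sx [t ht]] [sy [u hu]]; split; first by rewrite starD sx sy.
exists (t + u); rewrite rscD opprD addrACA.
by apply: le_trans (nmD _ _) _; exact: lerD.
Qed.

Lemma posZ t x : 0 <= t -> pos x -> pos (rsc A t * x).
Proof.
move=> t0 [sx [u hu]]; split; first by rewrite star_mul star_rsc sx rsc_comm.
by exists (t * u); rewrite rscM -mulrBr nm_rsc ger0_norm // ler_wpM2l.
Qed.

Lemma pos0 : pos 0.
Proof. by split; [rewrite star0|exists 0; rewrite rsc0 subr0 nm0]. Qed.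

Lemma pos_contraction x : star x = x -> nm x <= 1 -> pos (1 - x).
Proof.
move=> sx hx; split; first by rewrite starB star1 sx.
by exists 1; rewrite rsc1 opprB addrC subrK.
Qed.

(** For t > 0 the element T = 1 - x / t is a contraction, so [banach_sqrt] applies with K = 1; its
    bound nm S <= 1 makes the root sqrt t (1 - S) positive. *)
Lemma pos_sqrt x : pos x -> exists y, [/\ pos y, y * y = x &
  forall w, w * x = x * w -> w * y = y * w].
Proof.
move=> [sx [t ht]].
have t0 : 0 <= t by apply: le_trans ht; exact: nm_ge0.
have [tz|tn] := eqVneq t 0.
  have -> : x = 0.
    apply: nm_eq0; apply/le_anti; rewrite nm_ge0 andbT -nmN -[- x]add0r.
    by move: ht; rewrite tz rsc0.
  exists 0; split=> [||w _]; rewrite ?mulr0 ?mul0r //; exact: pos0.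
have tp : 0 < t by rewrite lt_neqAle eq_sym tn.
pose T := 1 - rsc A t^-1 * x.
have nT : nm T <= 1.
  have -> : T = rsc A t^-1 * (rsc A t - x) by rewrite mulrBr -rscM mulVf // rsc1.
  by rewrite nm_rsc ger0_norm ?invr_ge0 // ler_pdivrMl // mulr1.
have nTi i : nm (T ^+ i) <= 1.
  elim: i => [|i IH]; first by rewrite expr0 nm1.
  by rewrite exprS (le_trans (nmM _ _)) // mulr_ile1 // nm_ge0.
have [S [S2 NS commS starS]] := banach_sqrt (cstar_banach_ring A) nTi.
have sS : star S = S.
  apply: starS; [exact: starD|exact: star_mul|exact: star1|exact: star_rsc
    |exact: nm_star|].
  by rewrite /T starB star1 star_mul star_rsc sx rsc_comm.
have t2 : Num.sqrt t * Num.sqrt t = t by rewrite -expr2 sqr_sqrtr.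
exists (rsc A (Num.sqrt t) * (1 - S)); split.
- split; first by rewrite star_mul star_rsc starB star1 sS rsc_comm.
  exists (Num.sqrt t); rewrite mulrBr mulr1 opprB addrC subrK nm_rsc.
  by rewrite ger0_norm ?sqrtr_ge0 // ler_piMr // sqrtr_ge0.
- rewrite rscMM t2 -expr2 S2.
  by rewrite /T opprB addrC subrK mulrA -rscM divff // rsc1 mul1r.
- move=> w wx.
  have wS : w * S = S * w.
    by apply: commS; rewrite /T mulrBr mulrBl mulr1 mul1r rsc_mulCA -mulrA wx.
  by rewrite rsc_mulCA -mulrA mulrBr mulrBl wS mulr1 mul1r.
Qed.

(** By commutation u = s + i w satisfies [star u * u = 1], and s is the real part of u. *)
Lemma nm_sa_sum_sqr s w : star s = s -> star w = w -> s * w = w * s ->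
  s * s + w * w = 1 -> nm s <= 1.
Proof.
move=> ss sw sw_comm h.
pose j := csc A 'i%R; pose u := s + j * w.
have su : star u = s - j * w.
  by rewrite /u starD ss star_mul sw star_csc conjCi cscN mulrN -csc_comm.
have jC x : j * x = x * j by exact: csc_comm.
have jCA x z : x * (j * z) = j * (x * z) by exact: csc_mulCA.
have uu : star u * u = 1.
  have jj : j * j = -1 by rewrite -cscM -expr2 sqrCi cscN csc1.
  rewrite su /u mulrBl !mulrDr -!mulrA !jCA [j * (j * _)]mulrA jj mulN1r opprD opprK.
  by rewrite -sw_comm addrA addrK.
have nu : nm u <= 1.
  have := nmC u; rewrite uu; have := nm1 A; have := nm_ge0 u; nra.
have := nm_rsc 2 s; rewrite (_ : rsc A 2 * s = u + star u); last first.
  by rewrite su /u addrACA subrr addr0 (rscD A 1 1) rsc1 mulrDl mul1r.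
rewrite ger0_norm // => e.
have := nmD u (star u); rewrite e nm_star; lra.
Qed.

Lemma mulrn_rsc x n : x *+ n = rsc A n%:R * x.
Proof.
elim: n => [|n IHn]; first by rewrite rsc0 mul0r.
by rewrite mulrS IHn [in RHS]mulrS rscD rsc1 mulrDl mul1r.
Qed.

Lemma pos_unit_norm a : pos a -> pos (1 - a) -> nm a <= 1.
Proof.
move=> /pos_sqrt[s [[ss _] s2 scomm]] /pos_sqrt[w [[sw _] w2 wcomm]].
have sa : s * a = a * s by rewrite -s2 mulrA.
have swc : s * w = w * s by apply: wcomm; rewrite mulrBr mulrBl sa mulr1 mul1r.
have s1 : nm s <= 1.
  by apply: (nm_sa_sum_sqr ss sw swc); rewrite s2 w2 addrC subrK.
by rewrite -s2 (le_trans (nmM _ _)) // mulr_ile1 // nm_ge0.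
Qed.

(** For t > nm b, 1 - a / t = (1 - b / t) + (b - a) / t is positive, so [pos_unit_norm] bounds a /
    t. The slack e keeps t nonzero. *)
Lemma pos_le_nm a b : pos a -> pos (b - a) -> nm a <= nm b.
Proof.
move=> pa pba; have sb : star b = b.
  by have [] := posD pa pba; rewrite addrC subrK.
apply: le_eps => e e0; set t := nm b + e.
have t0 : 0 < t by rewrite ltr_wpDl // nm_ge0.
have ti : 0 <= t^-1 by rewrite invr_ge0 ltW.
have h : nm (rsc A t^-1 * a) <= 1.
  apply: pos_unit_norm; first exact: posZ.
  have -> : 1 - rsc A t^-1 * a = (1 - rsc A t^-1 * b) + rsc A t^-1 * (b - a).
    by rewrite mulrBr addrA subrK.
  apply: posD; last exact: posZ.
  apply: pos_contraction; first by rewrite star_mul star_rsc sb rsc_comm.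
  by rewrite nm_rsc ger0_norm // ler_pdivrMl // mulr1 /t lerDl ltW.
by move: h; rewrite nm_rsc ger0_norm // ler_pdivrMl // mulr1.
Qed.

Lemma pos_antisym x : pos x -> pos (- x) -> x = 0.
Proof.
move=> px; rewrite -[- x]add0r => nx; apply: nm_eq0.
by apply/le_anti; rewrite nm_ge0 andbT -(nm0 A) pos_le_nm.
Qed.

(** For z = y / sqrt t, the root w of 1 - z^2 satisfies w^2 + z^2 = 1, so nm w <= 1, while t - y^2 =
    t w^2. *)
Lemma sa_sqr_bound y t : star y = y -> nm y ^+ 2 <= t -> nm (rsc A t - y * y) <= t.
Proof.
move=> sy hy.
have [t0|tn] := eqVneq t 0.
  have -> : y = 0.
    apply: nm_eq0; apply/eqP; rewrite -sqrf_eq0; apply/eqP/le_anti.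
    by rewrite sqr_ge0 andbT -t0.
  by rewrite t0 mulr0 rsc0 subrr nm0.
have t0 : 0 < t by rewrite lt_neqAle eq_sym tn (le_trans _ hy) // sqr_ge0.
pose z := rsc A (Num.sqrt t)^-1 * y.
have st0 : 0 < Num.sqrt t by rewrite sqrtr_gt0.
have tt : (Num.sqrt t)^-1 * (Num.sqrt t)^-1 = t^-1.
  by rewrite -invfM -expr2 sqr_sqrtr // ltW.
have sz : star z = z by rewrite /z star_mul star_rsc sy rsc_comm.
have zz : z * z = rsc A t^-1 * (y * y) by rewrite /z rscMM tt.
have nz : nm (z * z) <= 1.
  have ti : 0 <= t^-1 by rewrite invr_ge0 ltW.
  rewrite zz nm_rsc ger0_norm // ler_pdivrMl // mulr1.
  by rewrite (le_trans (nmM _ _)) // -expr2.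
have [|w [[sw _] w2 wcomm]] := pos_sqrt (pos_contraction _ nz).
  by rewrite star_mul sz.
have zw : w * z = z * w.
  by symmetry; apply: wcomm; rewrite mulrBr mulrBl mulr1 mul1r mulrA.
have nw : nm w <= 1.
  by apply: (nm_sa_sum_sqr sw sz zw); rewrite w2 subrK.
have -> : rsc A t - y * y = rsc A t * (w * w).
  by rewrite w2 mulrBr mulr1 zz rscMl divff // rsc1 mul1r.
rewrite nm_rsc ger0_norm; last exact: ltW.
apply: ler_piMr; first exact: ltW.
by rewrite (le_trans (nmM _ _)) // mulr_ile1 // nm_ge0.
Qed.

Lemma pos_sqr y : star y = y -> pos (y * y).
Proof.
move=> sy; split; first by rewrite star_mul sy.
by exists (nm y ^+ 2); apply: sa_sqr_bound.
Qed.

(** Frees the witness in [pos] from the element, which is what passing to a limit of positive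
    elements requires. *)
Lemma pos_bound x t : pos x -> nm x <= t -> nm (rsc A t - x) <= t.
Proof.
move=> /pos_sqrt[y [[sy _] <- _]] h; apply: sa_sqr_bound => //.
by rewrite -nmC sy.
Qed.

Lemma pos_mul_comm x y : pos x -> pos y -> x * y = y * x -> pos (x * y).
Proof.
move=> /pos_sqrt[s [[ss _] s2 scomm]] /pos_sqrt[w [[sw _] w2 wcomm]] xy.
have sw_comm : s * w = w * s.
  by apply: wcomm; symmetry; apply: scomm; rewrite xy.
have -> : x * y = s * w * (s * w).
  by rewrite -s2 -w2 -!mulrA; congr (_ * _); rewrite !mulrA sw_comm.
by apply: pos_sqr; rewrite star_mul ss sw.
Qed.

(* If y * star y = a >= 0 and star y * y <= 0 is small, then
   n a^2 <= a (1 + a)^n = y (1 + star y * y)^n star y is bounded in n. *)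
Lemma pos_neg_star_mul y : pos (y * star y) -> pos (- (star y * y)) -> y = 0.
Proof.
wlog hy : y / nm (1 + star y * y) <= 1.
  move=> hw py ny; have [sc [t ht]] := ny.
  (* After division by t1, 1 + [star y * y] becomes (t1 - c) / t1 with c = - [star y * y] positive,
     and [pos_bound] gives norm at most 1 since t1 >= nm c. The 1 keeps t1 positive. *)
  pose t1 := Num.max 1 (nm (star y * y)).
  have t1p : 0 < t1 by rewrite lt_max ltr01.
  pose q := (Num.sqrt t1)^-1.
  have qq : q * q = t1^-1 by rewrite /q -invfM -expr2 sqr_sqrtr // ltW.
  pose z := rsc A q * y.
  have sz : star z = rsc A q * star y by rewrite /z star_mul star_rsc rsc_comm.
  have zz : star z * z = rsc A t1^-1 * (star y * y) by rewrite sz /z rscMM qq.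
  have zz' : z * star z = rsc A t1^-1 * (y * star y) by rewrite sz /z rscMM qq.
  have t1i : 0 <= t1^-1 by rewrite invr_ge0 ltW.
  suff z0 : z = 0.
    have q0 : q != 0 by rewrite invr_eq0 sqrtr_eq0 -ltNge.
    by rewrite -[y](rscV _ q0) -/z z0 mulr0.
  apply: hw.
  - have -> : 1 + star z * z = rsc A t1^-1 * (rsc A t1 - - (star y * y)).
      by rewrite mulrBr mulrN opprK -rscM mulVf ?gt_eqF // rsc1 zz.
    rewrite nm_rsc ger0_norm // ler_pdivrMl // mulr1.
    by apply: pos_bound => //; rewrite nmN le_max lexx orbT.
  - by rewrite zz'; exact: posZ.
  - by rewrite zz -mulrN; exact: posZ.
move=> pa _; set a := y * star y in pa.
have sa : star a = a by case: pa.
have paa : pos (a * a) by exact: pos_sqr.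
(* Bernoulli's inequality. Commutation of D with a is carried along because the product of two
   positive elements is known to be positive only if they commute. *)
have hD n : exists D, [/\ pos D, a * D = D * a & (1 + a) ^+ n = 1 + a *+ n + D].
  elim: n => [|n [D [pD aD hD]]].
    by exists 0; rewrite expr0 mulr0n !addr0 mulr0 mul0r; split => //; exact: pos0.
  exists (D + (D * a + (a * a) *+ n)); split.
  - apply: posD => //; apply: posD; first by apply: pos_mul_comm.
    by elim: n {hD} => [|n IHn]; [exact: pos0|rewrite mulrS; exact: posD].
  - by rewrite !mulrDr !mulrDl [a * (D * a)]mulrA aD mulrnAl mulrnAr mulrA.
  - rewrite exprSr hD mulrDr mulr1 !mulrDl mul1r mulrnAl mulrS.
    rewrite -[a + _ + D * a]addrA addrACA; congr (_ + (_ + _)); last exact: addrC.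
    by rewrite -addrA [a *+ n + a]addrC.
have push n : (1 + a) ^+ n * y = y * (1 + star y * y) ^+ n.
  elim: n => [|n IHn]; first by rewrite !expr0 mul1r mulr1.
  have e : (1 + a) * y = y * (1 + star y * y).
    by rewrite mulrDl mulrDr mul1r mulr1 mulrA.
  by rewrite exprSr -mulrA e mulrA IHn -mulrA -exprSr.
have hn n : n%:R * nm (a * a) <= nm y * nm y.
  have [D [pD aD hD']] := hD n.
  have -> : n%:R * nm (a * a) = nm ((a * a) *+ n).
    by rewrite mulrn_rsc nm_rsc ger0_norm.
  have e : a * (1 + a) ^+ n = (a * a) *+ n + (a + a * D).
    by rewrite hD' !mulrDr mulr1 mulrnAr addrCA addrA.
  have e' : a * (1 + a) ^+ n = y * (1 + star y * y) ^+ n * star y.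
    rewrite -push -mulrA -/a hD' !mulrDr !mulrDl mulr1 mul1r mulrnAr mulrnAl.
    by rewrite aD.
  apply: (@le_trans _ _ (nm (a * (1 + a) ^+ n))).
    apply: pos_le_nm.
      elim: {hD' push e e'} n => [|n IHn]; first exact: pos0.
      by rewrite mulrS; exact: posD.
    by rewrite e addrC addKr; apply: posD => //; exact: pos_mul_comm.
  rewrite e' (le_trans (nmM _ _)) // nm_star ler_wpM2r ?nm_ge0 //.
  rewrite (le_trans (nmM _ _)) // ler_piMr ?nm_ge0 //.
  elim: {hD' push e e'} n => [|n IHn]; first by rewrite expr0 nm1.
  by rewrite exprS (le_trans (nmM _ _)) // mulr_ile1 // nm_ge0.
have a0 : a = 0.
  apply: nm_eq0; apply/eqP; rewrite -sqrf_eq0 -nmC sa; apply/eqP.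
  apply/le_anti; rewrite nm_ge0 andbT.
  apply: (@le0_inv_nat _ _ (nm y * nm y)) => m.
  by rewrite ler_pdivlMr ?ltr0n // mulrC.
rewrite -[y]starK; have -> : star y = 0.
  by apply: nm_eq0; apply/eqP; rewrite -sqrf_eq0 -nmC starK -/a a0 nm0.
exact: star0.
Qed.

(* With b = b_+ - b_-, the witness is v = 2 sqrt |b| b_-. *)
Lemma sa_neg_part b : star b = b -> exists (n v : A),
  [/\ star n = n, star v = v, n * b * n = - (v * v) & (v = 0 -> pos b)].
Proof.
move=> sb; have [m [pm m2 mcomm]] := pos_sqrt (pos_sqr sb).
have [s [[ss _] s2 scomm]] := pos_sqrt pm.
have bm : b * m = m * b by apply: mcomm; rewrite mulrA.
pose n := m - b.
have sn : star n = n by rewrite /n starB sb; case: pm => ->.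
have nm_comm : n * m = m * n by rewrite /n mulrBl mulrBr bm.
have nb : n * b = - (m * n).
  by rewrite /n mulrBl mulrBr m2 opprB.
have sn_comm : s * n = n * s by symmetry; apply: scomm.
have nn : n * n = m * n + m * n.
  by rewrite {2}/n mulrBr nb opprK nm_comm.
have vv : s * n * (s * n) = m * (n * n).
  by rewrite -s2 -!mulrA; congr (_ * _); rewrite !mulrA sn_comm.
exists n, (s * n); split=> //.
- by rewrite star_mul sn ss sn_comm.
- by rewrite nb mulNr vv mulrA.
- move=> v0; have mnn : m * (n * n) = 0 by rewrite -vv v0 mulr0.
  (* n is 2 b_-, and n^2 = 2 m n turns m n^2 = 0 into n^3 = 0; a self-adjoint nilpotent element
     vanishes by the C*-identity. *)
  have n0 : n = 0.
    have n3 : n * (n * n) = 0.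
      by rewrite nn mulrDr mulrA nm_comm -mulrA mnn addr0.
    apply: nm_eq0; apply/eqP; rewrite -sqrf_eq0 -nmC sn -sqrf_eq0 -nmC.
    by rewrite star_mul sn -mulrA n3 mulr0 nm0.
  by have /eqP := n0; rewrite subr_eq0 => /eqP <-.
Qed.

(** For y = x n, with n twice the negative part of [star x * x], [star y * y] is - v^2. Since y y^*
    + y^* y is half of h^2 + g^2 with h, g self-adjoint, y y^* is positive, and [pos_neg_star_mul],
    in place of comparing spectra, forces y = 0. *)
Lemma pos_star_mul x : pos (star x * x).
Proof.
have sb : star (star x * x) = star x * x by rewrite star_mul starK.
have [n [v [sn sv nbn vpos]]] := sa_neg_part sb; apply: vpos.
pose y := x * n.
have yy : star y * y = - (v * v) by rewrite -nbn /y star_mul sn !mulrA.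
have pvv := pos_sqr sv.
suff y0 : y = 0.
  apply: nm_eq0; apply/eqP; rewrite -sqrf_eq0 -nmC sv.
  by have := yy; rewrite y0 mulr0 => /esym/eqP; rewrite oppr_eq0 => /eqP ->; rewrite nm0.
apply: pos_neg_star_mul; last by rewrite yy opprK.
pose h := y + star y; pose g := csc A 'i%R * (y - star y).
have sh : star h = h by rewrite /h starD starK addrC.
have sg : star g = g.
  rewrite /g star_mul star_csc conjCi starB starK -csc_comm cscN mulNr -mulrN.
  by rewrite opprB.
have hg : h * h + g * g = (y * star y + star y * y) *+ 2.
  have -> : g * g = - ((y - star y) * (y - star y)).
    rewrite /g -mulrA csc_mulCA mulrA -cscM -expr2 sqrCi cscN csc1 mulN1r.
    by [].
  exact: sqrD_sub_sqrB.
have -> : y * star y = rsc A 2^-1 * (h * h + g * g) + v * v.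
  by rewrite hg mulrn_rsc rscMl mulVf ?pnatr_eq0 // rsc1 mul1r yy subrK.
apply: posD => //; apply: posZ; first by rewrite invr_ge0.
by apply: posD; exact: pos_sqr.
Qed.

Lemma pos_conj w x : pos x -> pos (star w * x * w).
Proof.
move=> /pos_sqrt[s [[ss _] <- _]].
have -> : star w * (s * s) * w = star (s * w) * (s * w).
  by rewrite star_mul ss !mulrA.
exact: pos_star_mul.
Qed.

(** A first-order test: dividing by t and letting t tend to 0 removes the quadratic term. *)
Lemma pos_infinitesimal a b : star a = a ->
  (forall t : R, 0 < t -> pos (rsc A t * a + rsc A (t * t) * b)) -> pos a.
Proof.
move=> sa h; split=> //.
have h' (t : R) : 0 < t -> pos (a + rsc A t * b).
  move=> t0; have := posZ (_ : 0 <= t^-1) (h t t0); rewrite invr_ge0 ltW //.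
  move=> /(_ isT); rewrite mulrDr !rscMl mulVf ?gt_eqF // mulrA mulVf ?gt_eqF //.
  by rewrite mul1r rsc1 mul1r.
exists (nm a + nm b); apply: le_eps => e e0.
pose t := Num.min 1 (e / (nm b + 1)).
have b1 : 0 < nm b + 1 by rewrite ltr_wpDl // nm_ge0.
have t0 : 0 < t by rewrite lt_min ltr01 divr_gt0.
have t1 : t <= 1 by rewrite ge_min lexx.
have tb : t * nm b <= e.
  have : t <= e / (nm b + 1) by rewrite ge_min lexx orbT.
  rewrite ler_pdivlMr // mulrDr mulr1; lra.
have nt : nm (a + rsc A t * b) <= nm a + nm b.
  apply: le_trans (nmD _ _) _; rewrite lerD2l nm_rsc gtr0_norm //.
  by rewrite ler_piMl // nm_ge0.
have := pos_bound (h' t t0) nt; set c := rsc A _.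
have := nmD (c - (a + rsc A t * b)) (rsc A t * b).
rewrite nm_rsc gtr0_norm // opprD addrA subrK; lra.
Qed.

Lemma cstar_ge0P x : cstar_ge0 x <-> pos x.
Proof.
split=> [[y ->]|/pos_sqrt[y [[sy _] <- _]]]; first exact: pos_star_mul.
by exists y; rewrite sy.
Qed.
End Positive.

(** * Positive matrices *)

Section MatrixForms.
Variables (R : realType) (A : cstarType R).

Lemma star_sum (I : Type) (r : seq I) (P : pred I) (F : I -> A) :
  star (\sum_(i <- r | P i) F i) = \sum_(i <- r | P i) star (F i).
Proof. exact: (big_morph _ (@starD R A) (star0 A)). Qed.

Lemma pos_sum (I : Type) (r : seq I) (P : pred I) (F : I -> A) :
  (forall i, P i -> pos (F i)) -> pos (\sum_(i <- r | P i) F i).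
Proof. by move=> h; apply: big_ind => //; [exact: pos0|exact: posD]. Qed.

Lemma nm_sum (I : Type) (r : seq I) (P : pred I) (F : I -> A) :
  nm (\sum_(i <- r | P i) F i) <= \sum_(i <- r | P i) nm (F i).
Proof.
elim/big_rec2: _ => [|i y x _ h]; first by rewrite nm0.
by apply: le_trans (nmD _ _) _; rewrite lerD2l.
Qed.

(** Rectangular version of [mxstar], convertible to it on square matrices. *)
Definition ctr m n (X : 'M[A]_(m, n)) : 'M[A]_(n, m) := (map_mx (@star R A) X)^T.

Lemma ctrE m n (X : 'M[A]_(m, n)) i j : ctr X i j = star (X j i).
Proof. by rewrite !mxE. Qed.

Lemma ctrD m n (X Y : 'M[A]_(m, n)) : ctr (X + Y) = ctr X + ctr Y.
Proof. by apply/matrixP => i j; rewrite !mxE starD. Qed.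

Lemma ctrN m n (X : 'M[A]_(m, n)) : ctr (- X) = - ctr X.
Proof. by apply/matrixP => i j; rewrite !mxE starN. Qed.

Lemma ctrM m n p (X : 'M[A]_(m, n)) (Y : 'M[A]_(n, p)) :
  ctr (X *m Y) = ctr Y *m ctr X.
Proof.
apply/matrixP => i j; rewrite !mxE star_sum; apply: eq_bigr => k _.
by rewrite star_mul !mxE.
Qed.

Lemma ctrK m n (X : 'M[A]_(m, n)) : ctr (ctr X) = X.
Proof. by apply/matrixP => i j; rewrite !mxE starK. Qed.

Lemma ctr_scalar n (a : A) : ctr (a%:M : 'M[A]_n) = (star a)%:M.
Proof.
apply/matrixP => i j; rewrite !mxE eq_sym.
by case: eqP => _; rewrite ?mulr1n // mulr0n star0.
Qed.

Definition nmx n (X : 'M[A]_n) : R := \sum_i \sum_j nm (X i j).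

Lemma nmx_entry n (X : 'M[A]_n) i j : nm (X i j) <= nmx X.
Proof.
rewrite /nmx (bigD1 i) //= (bigD1 j) //= -[X in _ <= X]addrA ler_wpDr // addr_ge0 //.
  by apply: sumr_ge0 => k _; exact: nm_ge0.
by apply: sumr_ge0 => k _; apply: sumr_ge0 => l _; exact: nm_ge0.
Qed.

Lemma nmx_ctr n (X : 'M[A]_n) : nmx (ctr X) = nmx X.
Proof.
rewrite /nmx exchange_big; apply: eq_bigr => i _; apply: eq_bigr => j _.
by rewrite !mxE nm_star.
Qed.

Lemma nmx_le n (X : 'M[A]_n) C : (forall i j, nm (X i j) <= C) ->
  nmx X <= n%:R * (n%:R * C).
Proof.
move=> h; have -> : n%:R * (n%:R * C) = \sum_(i < n) \sum_(j < n) C.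
  by rewrite !sumr_const card_ord !mulr_natl.
by apply: ler_sum => i _; apply: ler_sum => j _.
Qed.

Lemma nmxM n (X Y : 'M[A]_n) : nmx (X *m Y) <= nmx X * nmx Y.
Proof.
have h i j : nm ((X *m Y) i j) <= \sum_k nm (X i k) * nm (Y k j).
  rewrite mxE (le_trans (nm_sum _ _ _)) //; apply: ler_sum => k _; exact: nmM.
rewrite {1}/nmx; apply: (@le_trans _ _ (\sum_i \sum_k nm (X i k) * nmx Y)).
  apply: ler_sum => i _.
  apply: (@le_trans _ _ (\sum_j \sum_k nm (X i k) * nm (Y k j))).
    by apply: ler_sum => j _.
  rewrite exchange_big; apply: ler_sum => k _; rewrite -mulr_sumr.
  rewrite ler_wpM2l ?nm_ge0 // /nmx [X in _ <= X](bigD1 k) //= lerDl.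
  by apply: sumr_ge0 => l _; apply: sumr_ge0 => j _; exact: nm_ge0.
rewrite /nmx mulr_suml; apply: ler_sum => i _; by rewrite mulr_suml.
Qed.

Lemma matrix_banach_ring n :
  banach_ring (@nmx n) (fun a => (rsc A a)%:M : 'M[A]_n).
Proof.
have nmxD (X Y : 'M[A]_n) : nmx (X + Y) <= nmx X + nmx Y.
  rewrite /nmx -big_split; apply: ler_sum => i _; rewrite -big_split.
  by apply: ler_sum => j _; rewrite mxE; exact: nmD.
have scalE a (X : 'M[A]_n) i j : ((rsc A a)%:M *m X) i j = rsc A a * X i j.
  by rewrite mul_scalar_mx mxE.
split.
- move=> X h; apply/matrixP => i j; rewrite mxE; apply: nm_eq0; apply/le_anti.
  by rewrite nm_ge0 andbT -h nmx_entry.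
- exact: nmxD.
- move=> X; apply: eq_bigr => i _; apply: eq_bigr => j _; by rewrite mxE nmN.
- exact: nmxM.
- by move=> a b; rewrite rscD; exact: raddfD.
- by move=> a b; rewrite rscM; exact: scalar_mxM.
- by rewrite rsc1.
- move=> a X; apply/matrixP => i j; rewrite scalE.
  rewrite mxE (bigD1 j) //= big1 ?addr0 => [|k kj]; last first.
    by rewrite mxE (negbTE kj) mulr0n mulr0.
  by rewrite mxE eqxx mulr1n rsc_comm.
- move=> a X; rewrite /nmx mulr_sumr; apply: ler_sum => i _.
  by rewrite mulr_sumr; apply: ler_sum => j _; rewrite scalE nm_rsc.
- move=> u C hu.
  have C0 : 0 <= C.
    apply: le_trans (_ : nmx (u (0 + 0)%N - u 0%N) <= _).
      by apply: sumr_ge0 => i _; apply: sumr_ge0 => j _; exact: nm_ge0.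
    by rewrite -[C]divr1 (hu 0%N).
  have hl i j : exists l, forall m, nm (l - u m i j) <= C / m.+1%:R.
    apply: (nm_cauchy (u := fun m => u m i j)) => m k; apply: le_trans (hu m k).
    by have := nmx_entry (u (m + k)%N - u m) i j; rewrite !mxE.
  pose L : 'M[A]_n := \matrix_(i, j) projT1 (cid (hl i j)).
  have hL i j m : nm (L i j - u m i j) <= C / m.+1%:R.
    by rewrite mxE; case: cid.
  (* Summing entrywise limits costs a factor n^2; passing through [u (m + k)] puts it on a term that
     vanishes as k grows, which keeps the constant C. *)
  exists L => m; rewrite -subr_le0.
  apply: (@le0_inv_nat _ _ (n%:R * (n%:R * C))) => k.
  rewrite lerBlDr -(subrKA (u (m + k)%N) L).
  apply: le_trans (nmxD _ _) _; apply: lerD (hu m k).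
  rewrite -!mulrA; apply: nmx_le => i j; rewrite !mxE.
  have := hL i j (m + k)%N; rewrite mxE => h; apply: le_trans h _.
  by rewrite ler_wpM2l // lef_pV2 ?posrE ?ltr0n // ler_nat ltnS leq_addl.
Qed.

(** Positivity of the A-valued quadratic form on columns over A; it agrees with [mx_ge0] by
    [fpos_sqr] and [fpos_mx_ge0]. *)
Definition fpos n (X : 'M[A]_n) :=
  ctr X = X /\ forall b : 'cV[A]_n, pos ((ctr b *m X *m b) 0 0).

Lemma fposD n (X Y : 'M[A]_n) : fpos X -> fpos Y -> fpos (X + Y).
Proof.
move=> [sX hX] [sY hY]; split; first by rewrite ctrD sX sY.
by move=> b; rewrite mulmxDr mulmxDl mxE; exact: posD.
Qed.

Lemma fpos_conj m n (W : 'M[A]_(m, n)) X : fpos X -> fpos (ctr W *m X *m W).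
Proof.
move=> [sX hX]; split; first by rewrite !ctrM ctrK sX mulmxA.
by move=> b; have := hX (W *m b); rewrite ctrM !mulmxA.
Qed.

Lemma fpos1 n : fpos (1%:M : 'M[A]_n).
Proof.
split; first by rewrite ctr_scalar star1.
move=> b; rewrite mulmx1 mxE; apply: pos_sum => i _.
by rewrite ctrE; exact: pos_star_mul.
Qed.

Lemma fpos_sqr m n (Y : 'M[A]_(m, n)) : fpos (ctr Y *m Y).
Proof. by have := fpos_conj Y (fpos1 m); rewrite mulmx1. Qed.

Lemma fpos_diag n (X : 'M[A]_n) i : fpos X -> pos (X i i).
Proof.
move=> [_ /(_ (delta_mx i 0))].
have -> : ctr (delta_mx i 0) = delta_mx 0 i :> 'rV[A]_n.
  apply/matrixP => j k; rewrite !mxE andbC.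
  by case: (_ && _); rewrite ?mulr1n ?star1 // mulr0n star0.
by rewrite -rowE -colE !mxE.
Qed.

Lemma fpos0 n : fpos (0 : 'M[A]_n).
Proof.
split; first by rewrite -[X in ctr X](subrr 0) ctrD ctrN subrr.
by move=> b; rewrite mulmx0 mul0mx mxE; exact: pos0.
Qed.

Lemma fpos_scale n a (X : 'M[A]_n) : 0 <= a -> fpos X -> fpos ((rsc A a)%:M *m X).
Proof.
move=> a0 [sX hX]; split.
  by rewrite ctrM ctr_scalar star_rsc sX -[LHS](br_kC (matrix_banach_ring n)).
move=> b; have := posZ a0 (hX b); congr pos.
have e : ctr b *m ((rsc A a)%:M *m X) = rsc A a *: (ctr b *m X).
  rewrite mul_scalar_mx; apply/matrixP => i j.
  rewrite mxE [RHS]mxE [X in _ = _ * X]mxE mulr_sumr; apply: eq_bigr => k _.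
  by rewrite [(_ *: X) _ _]mxE rsc_mulCA.
by rewrite e -scalemxAl [RHS]mxE.
Qed.
End MatrixForms.

(** * Square roots of positive matrices *)

Section MatrixSquareRoot.
Variables (R : realType) (A : cstarType R) (n : nat).
Implicit Types (X T : 'M[A]_n) (b : 'cV[A]_n).

(** T^k - T^(k+1) = T^k (1 - T) is positive: for k = 2l it is 1 - T conjugated by T^l, for k = 2l +
    1 it is T (1 - T) = T (1 - T) T + (1 - T) T (1 - T) conjugated by T^l. Hence T^(2k) <= 1, and
    its (j, j) entry is the sum of the squares x^* x over the entries x of column j of T^k. *)
Lemma fpos_powers T : fpos T -> fpos (1 - T) ->
  forall k i j, nm ((T ^+ k) i j) <= 1.
Proof.
move=> pT pT1.
have sT k : ctr (T ^+ k) = T ^+ k.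
  elim: k => [|k IH]; first by rewrite expr0 ctr_scalar star1.
  by rewrite exprS ctrM IH; case: pT => -> _; rewrite -[LHS]exprSr -exprS.
have conjT k X : fpos X -> fpos (T ^+ k * X * T ^+ k).
  by move=> /(fpos_conj (T ^+ k)); rewrite sT.
have comm k : T ^+ k * (1 - T) = (1 - T) * T ^+ k.
  by rewrite mulrBr mulrBl mulr1 mul1r -exprS -exprSr.
have step k : fpos (T ^+ k - T ^+ k.+1).
  have -> : T ^+ k - T ^+ k.+1 = T ^+ k * (1 - T) by rewrite mulrBr mulr1 -exprSr.
  have ev l : fpos (T ^+ (l + l) * (1 - T)).
    by rewrite exprD -mulrA comm mulrA; exact: conjT.
  have -> : k = (odd k + (k./2 + k./2))%N by rewrite addnn odd_double_half.
  case: (odd k) => /=; last exact: ev.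
  set l := k./2; rewrite add1n.
  have -> : T ^+ (l + l).+1 * (1 - T) = T ^+ l * (T * (1 - T)) * T ^+ l.
    by rewrite -addnS exprD exprS -!mulrA comm.
  apply: conjT.
  have -> : T * (1 - T) = T * (1 - T) * T + (1 - T) * T * (1 - T).
    have c1 := comm 1%N; rewrite expr1 in c1.
    by rewrite -c1 -mulrDr [T + _]addrC subrK mulr1.
  apply: fposD.
    have := fpos_conj T pT1; have := sT 1%N; rewrite expr1 => -> //.
  have := fpos_conj (1 - T) pT.
  by have -> : ctr (1 - T) = 1 - T by case: pT1.
have pow k : fpos (1 - T ^+ k).
  elim: k => [|k IH]; first by rewrite expr0 subrr; exact: fpos0.
  by rewrite -(subrKA (T ^+ k)); exact: fposD.
move=> k i j.
pose F l := star ((T ^+ k) l j) * (T ^+ k) l j.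
have pF l : pos (F l) by exact: pos_star_mul.
have pj : pos (1 - \sum_l F l).
  have := fpos_diag j (pow (k + k)%N); congr pos.
  rewrite exprD mxE mxE eqxx mulr1n mxE [in LHS]mxE; congr (1 - _).
  by apply: eq_bigr => l _; rewrite -{1}(sT k) ctrE.
have : nm (F i) <= nm (1 : A).
  apply: pos_le_nm => //; rewrite -(subrKA (\sum_l F l)).
  apply: posD => //; rewrite (bigD1 i) //= addrC addrK; exact: pos_sum.
rewrite nmC => h.
have : nm ((T ^+ k) i j) ^+ 2 <= 1 by apply: le_trans h (nm1 A).
by rewrite -[X in _ <= X](expr1n _ 2%N) ler_pXn2r // ?nnegrE ?nm_ge0.
Qed.

(* Sum over i, j of
   (b_i - x_ij b_j)^* (b_i - x_ij b_j) + b_j^* (c - x_ij^* x_ij) b_j >= 0. *)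
Lemma fpos_upper_bound X : ctr X = X ->
  exists2 t : R, 0 < t & fpos ((rsc A t)%:M - X).
Proof.
move=> sX.
pose c : R := nmx X ^+ 2.
have c0 : 0 <= c by exact: sqr_ge0.
(* The sum over i, j is n (1 + c) b^* b - 2 b^* X b. The 1 added to t makes the bound positive when
   n = 0. *)
pose t : R := n%:R * (1 + c) / 2.
exists (t + 1).
  by rewrite ltr_wpDl // mulr_ge0 // mulr_ge0 // addr_ge0.
have -> : (rsc A (t + 1))%:M - X = ((rsc A t)%:M - X) + 1%:M.
  by rewrite rscD raddfD rsc1 /= addrAC.
apply: fposD; last exact: fpos1.
split; first by rewrite ctrD ctrN sX ctr_scalar star_rsc.
move=> b.
pose u i j := star (b i 0) * (X i j * b j 0).
pose S := \sum_i star (b i 0) * b i 0.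
have qE : (ctr b *m X *m b) 0 0 = \sum_i \sum_j u i j.
  rewrite -mulmxA mxE; apply: eq_bigr => i _; rewrite ctrE mxE mulr_sumr.
  by apply: eq_bigr.
have qS : star (\sum_i \sum_j u i j) = \sum_i \sum_j u i j.
  rewrite -qE -[LHS]ctrE !ctrM sX ctrK mulmxA.
  by [].
have hD i j : pos (star (b i 0) * b i 0 + rsc A c * (star (b j 0) * b j 0)
                   - (u i j + star (u i j))).
  pose x := X i j; pose d := b i 0 - x * b j 0.
  have px : pos (rsc A c - star x * x).
    split; first by rewrite starB star_rsc star_mul starK.
    exists c; rewrite opprB addrC subrK nmC.
    by rewrite ler_pXn2r ?nnegrE ?nm_ge0 ?nmx_entry // /nmx;
      apply: sumr_ge0 => ? _; apply: sumr_ge0 => ? _; exact: nm_ge0.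
  have [e [pe e2 _]] := pos_sqrt px.
  have -> : star (b i 0) * b i 0 + rsc A c * (star (b j 0) * b j 0)
              - (u i j + star (u i j)) =
            star d * d + star (e * b j 0) * (e * b j 0).
    have -> : star (e * b j 0) * (e * b j 0) =
        rsc A c * (star (b j 0) * b j 0) - star (x * b j 0) * (x * b j 0).
      have se : star e = e by case: pe.
      rewrite !star_mul se -!mulrA [e * (e * _)]mulrA e2 mulrBl mulrBr.
      by rewrite -rsc_mulCA -!mulrA.
    have -> : star d * d = star (b i 0) * b i 0 - u i j
        - star (u i j) + star (x * b j 0) * (x * b j 0).
      rewrite /d starB mulrBl !mulrBr opprB [star (x * _) * _ - _]addrC addrA.
      by rewrite /u -/x [star (star _ * _)]star_mul starK.
    rewrite [rsc A c * _ - _ in RHS]addrC [in RHS]addrA addrK.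
    by rewrite opprD addrA [_ + rsc A c * _ - _]addrAC [LHS]addrAC.
  by apply: posD; exact: pos_star_mul.
have -> : (ctr b *m ((rsc A t)%:M - X) *m b) 0 0 = rsc A 2^-1 *
    \sum_i \sum_j (star (b i 0) * b i 0 + rsc A c * (star (b j 0) * b j 0)
                   - (u i j + star (u i j))).
  have -> : (ctr b *m ((rsc A t)%:M - X) *m b) 0 0 = rsc A t * S - \sum_i \sum_j u i j.
    rewrite mulmxBr mulmxBl mxE [X in _ + X]mxE qE; congr (_ + _).
    rewrite mxE mulr_sumr; apply: eq_bigr => i _.
    rewrite mulrA rsc_comm -[star _]ctrE; congr (_ * _).
    rewrite mxE (bigD1 i) //= big1 ?addr0 => [|l li]; last first.
      by rewrite [(_%:M) _ _]mxE (negbTE li) mulr0n mulr0.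
    by rewrite [(_%:M) _ _]mxE eqxx mulr1n.
  set q := \sum_i \sum_j u i j in qS *.
  have -> : \sum_i \sum_j (star (b i 0) * b i 0 + rsc A c * (star (b j 0) * b j 0)
                   - (u i j + star (u i j))) =
            S *+ n + (rsc A c * S) *+ n - (q + q).
    under eq_bigr do rewrite sumrB big_split /= big_split /=.
    rewrite sumrB big_split /= big_split /=; congr (_ + _ - (_ + _)).
    - by under eq_bigr do rewrite sumr_const card_ord; rewrite -sumrMnl.
    - by rewrite sumr_const card_ord mulr_sumr.
    - by rewrite -qS star_sum; apply: eq_bigr => i _; rewrite star_sum.
  rewrite -mulr2n !mulrn_rsc mulrBr [_ * (_ * q)]rscMl mulVf ?pnatr_eq0 // rsc1 mul1r.
  congr (_ - _); rewrite mulrDr !rscMl -mulrDl -rscD; congr (rsc A _ * _).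
  by rewrite /t; ring.
apply: posZ; first by rewrite invr_ge0.
by apply: pos_sum => i _; apply: pos_sum => j _.
Qed.

(** T = 1 - X / t lies between 0 and 1, so its powers have norm at most n^2 and [banach_sqrt]
    applies; sqrt t (1 - S) is self-adjoint with square X. *)
Lemma fpos_mx_ge0 X : fpos X -> mx_ge0 X.
Proof.
move=> pX; have sX : ctr X = X by case: pX.
have [t t0 pt] := fpos_upper_bound sX.
have ti0 : 0 <= t^-1 by rewrite invr_ge0 ltW.
have br := matrix_banach_ring A n.
pose k (a : R) : 'M[A]_n := (rsc A a)%:M.
pose T : 'M[A]_n := k t^-1 * (k t - X).
have kti : k t^-1 * k t = 1.
  by rewrite /k -(br_kM br) mulVf ?gt_eqF // (br_k1 br).
have T1 : 1 - T = k t^-1 * X by rewrite /T mulrBr kti opprB addrC subrK.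
have pT : fpos T by exact: fpos_scale.
have pT1 : fpos (1 - T) by rewrite T1; exact: fpos_scale.
have hT i : nmx (T ^+ i) <= n%:R * (n%:R * 1).
  by apply: nmx_le; exact: fpos_powers.
have [S [S2 _ _ starS]] := banach_sqrt br hT.
have sS : ctr S = S.
  apply: starS.
  - exact: ctrD.
  - exact: ctrM.
  - by rewrite ctr_scalar star1.
  - by move=> a; rewrite ctr_scalar star_rsc.
  - exact: nmx_ctr.
  - by case: pT.
exists (k (Num.sqrt t) * (1 - S)).
have -> : mxstar (k (Num.sqrt t) * (1 - S)) = k (Num.sqrt t) * (1 - S).
  rewrite -[LHS]/(ctr _) ctrM ctr_scalar star_rsc ctrD ctrN sS ctr_scalar star1.
  by rewrite -[LHS](br_kC br).
have tt : Num.sqrt t * Num.sqrt t = t by rewrite -expr2 sqr_sqrtr // ltW.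
rewrite -[RHS]/(k (Num.sqrt t) * (1 - S) * (k (Num.sqrt t) * (1 - S))).
rewrite -mulrA [(1 - S) * _]mulrA -(br_kC br) -mulrA -expr2 S2 T1 mulrA.
rewrite -(br_kM br) tt mulrA -(br_kM br) divff ?gt_eqF //.
by rewrite (br_k1 br) mul1r.
Qed.

End MatrixSquareRoot.

(** * *-homomorphisms and the injective envelope *)

Lemma star_mul_eq0 (R : realType) (A : cstarType R) (x : A) :
  star x * x = 0 -> x = 0.
Proof. by move=> h; apply: nm_eq0; apply/eqP; rewrite -sqrf_eq0 -nmC h nm0. Qed.

Section StarHom.
Variables (R : realType) (A B : cstarType R) (f : A -> B).
Hypothesis hf : star_hom f.

Lemma hom_lin c x y : f (c *: x + y) = c *: f x + f y.
Proof. exact: (star_hom_linear hf). Qed.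

Lemma hom0 : f 0 = 0.
Proof.
have := hom_lin (-1) 0 0.
by rewrite scaler0 addr0 scaleN1r addNr.
Qed.

Lemma homZ c x : f (c *: x) = c *: f x.
Proof.
by have := hom_lin c x 0; rewrite !addr0 hom0 addr0.
Qed.

Lemma homD x y : f (x + y) = f x + f y.
Proof.
by have := hom_lin 1 x y; rewrite !scale1r.
Qed.

Lemma homN x : f (- x) = - f x.
Proof. by rewrite -scaleN1r homZ scaleN1r. Qed.

Lemma homB x y : f (x - y) = f x - f y.
Proof. by rewrite homD homN. Qed.

Lemma hom_sum (I : Type) (r : seq I) (P : pred I) (F : I -> A) :
  f (\sum_(i <- r | P i) F i) = \sum_(i <- r | P i) f (F i).
Proof. exact: (big_morph f homD hom0). Qed.

Lemma hom_pos x : pos x -> pos (f x).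
Proof.
move=> /pos_sqrt[y [[sy _] <- _]]; rewrite (star_hom_mul hf).
by apply: pos_sqr; rewrite -(star_hom_star hf) sy.
Qed.

Lemma hom_mx_ge0 n (X : 'M[A]_n) : mx_ge0 X -> mx_ge0 (map_mx f X).
Proof.
move=> [Y ->]; exists (map_mx f Y); apply/matrixP => i j.
rewrite !mxE hom_sum; apply: eq_bigr => k _.
by rewrite (star_hom_mul hf) !mxE (star_hom_star hf).
Qed.

(** 0 <= b <= nm b, for b = [star x * x], is carried to 0 <= f b <= nm b f 1, where f 1 may differ
    from 1 but is a projection, of norm at most 1. *)
Lemma hom_contractive x : nm (f x) <= nm x.
Proof.
rewrite -(@ler_pXn2r _ 2%N) ?nnegrE ?nm_ge0 // -!nmC -(star_hom_star hf).
rewrite -(star_hom_mul hf); set b := star x * x.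
have pb : pos b by exact: pos_star_mul.
set t := nm b.
have pt : pos (rsc A t - b).
  split; first by rewrite starB star_rsc; case: pb => ->.
  by exists t; rewrite opprB addrC subrK.
have t0 : 0 <= t by exact: nm_ge0.
have pe : pos (f 1).
  have -> : f 1 = star (f 1) * f 1.
    by rewrite -(star_hom_star hf) -(star_hom_mul hf) star1 mulr1.
  exact: pos_star_mul.
have e1 : nm (f 1) <= 1.
  have : nm (f 1) ^+ 2 = nm (f 1).
    by rewrite -nmC -(star_hom_star hf) -(star_hom_mul hf) star1 mulr1.
  have := nm_ge0 (f 1); nra.
have frt : f (rsc A t) = rsc B t * f 1 by rewrite {1}/rsc {1}/csc homZ cscE.
apply: (@le_trans _ _ (nm (rsc B t * f 1))).
  apply: pos_le_nm; first exact: hom_pos.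
  by rewrite -frt -homB; exact: hom_pos.
by rewrite nm_rsc ger0_norm // ler_piMr.
Qed.

(* With n and v from sa_neg_part, (n e)^* b (n e) = - (v e)^* (v e) has a positive
   image under f, so v e = 0 for all e in E. *)
Lemma pos_reflect (E : set A) b :
  (forall a e, E e -> E (a * e)) ->
  (forall a, (forall e, E e -> a * e = 0) -> a = 0) ->
  (forall e, E e -> f e = 0 -> e = 0) ->
  star b = b -> (forall e, E e -> pos (f (star e * b * e))) -> pos b.
Proof.
move=> Eid Eess finj sb hb.
have [n [v [sn sv nbn vpos]]] := sa_neg_part sb; apply: vpos.
apply: Eess => e Ee; apply: finj; first exact: Eid.
apply: star_mul_eq0; apply: pos_antisym; first exact: pos_star_mul.
rewrite -(star_hom_star hf) -(star_hom_mul hf) -homN.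
have := hb (n * e) (Eid _ _ Ee); congr pos; congr (f _).
rewrite !star_mul sn sv -!mulrA [n * (b * _)]mulrA [n * b * _]mulrA nbn.
by rewrite mulNr mulrN !mulrA.
Qed.
End StarHom.

(* The elements s of D acting on the ideal j(E) as an element a of A form an
   operator system, on which s |-> a is well defined and completely positive
   because E is essential. *)
Lemma envelope_extension (R : realType) (A I : cstarType R) (iI : A -> I)
    (hI : injective_envelope iI) (D : cstarType R) (j : A -> D) (E : set A) :
  cstar_inclusion j ->
  (forall a e, E e -> E (a * e)) ->
  (forall a, (forall e, E e -> a * e = 0) -> a = 0) ->
  exists2 h : D -> I, ucp setT setT h &
    forall s a, (forall e, E e -> s * j e = j (a * e) /\
                               star s * j e = j (star a * e)) -> h s = iI a.
Proof.
move=> [hj jinj] Eid Eess.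
pose Rel s a := forall e, E e -> s * j e = j (a * e) /\ star s * j e = j (star a * e).
have Rel_uniq s a b : Rel s a -> Rel s b -> a = b.
  move=> ha hb; apply/eqP; rewrite -subr_eq0; apply/eqP; apply: Eess => e Ee.
  by apply: jinj; rewrite mulrBl (homB hj) -(ha e Ee).1 -(hb e Ee).1 subrr (hom0 hj).
have Rel_lin c s t a b : Rel s a -> Rel t b -> Rel (c *: s + t) (c *: a + b).
  move=> ha hb e Ee; have [ha1 ha2] := ha e Ee; have [hb1 hb2] := hb e Ee.
  split.
    by rewrite !mulrDl (homD hj) -hb1 !cscE -!mulrA -!cscE (homZ hj) -ha1.
  rewrite !starD !starZ !mulrDl (homD hj) -hb2 !cscE -!mulrA -!cscE (homZ hj).
  by rewrite -ha2.
have Rel_star s a : Rel s a -> Rel (star s) (star a).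
  by move=> h e Ee; rewrite !starK; have [? ?] := h e Ee.
(* This holds even if j is not unital; [j 1] is then another element related to 1. *)
have Rel1 : Rel 1 1 by move=> e Ee; rewrite !star1 !mul1r.
have Rel0 : Rel 0 0 by move=> e Ee; rewrite !star0 !mul0r (hom0 hj).
pose S := [set s | exists a, Rel s a].
pose F s := if pselect (S s) is left h then projT1 (cid h) else 0.
have FR s : S s -> Rel s (F s).
  by rewrite /F; case: pselect => // h _; case: cid.
have FE s a : Rel s a -> F s = a.
  by move=> h; apply: (Rel_uniq s _ _ _ h); apply: FR; exists a.
have hi : star_hom iI by case: (env_inclusion hI).
have opS : operator_system S.
  split.
  - split; first by exists 0.
    move=> c x y [a ha] [b hb]; exists (c *: a + b); exact: Rel_lin.
  - by exists 1.
  - by move=> x [a ha]; exists (star a); exact: Rel_star.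
have opT : operator_system (setT : set D) by split.
have ucpf : ucp S setT (iI \o F).
  split=> //.
  - move=> c x y Sx Sy /=; rewrite (FE _ _ (Rel_lin c _ _ _ _ (FR _ Sx) (FR _ Sy))).
    by rewrite (hom_lin hi).
  - by rewrite /= (FE _ _ Rel1) (env_one hI).
  - move=> n X SX [Y XY].
    have [sX pX] : fpos X by rewrite XY; exact: fpos_sqr.
    pose Z : 'M[A]_n := map_mx F X.
    suff pZ : fpos Z.
      have := hom_mx_ge0 hi (fpos_mx_ge0 pZ).
      by rewrite /Z -map_mx_comp.
    have sZ : ctr Z = Z.
      apply/matrixP => i k; rewrite ctrE !mxE; symmetry; apply: FE.
      have -> : X i k = star (X k i) by rewrite -ctrE sX.
      by apply: Rel_star; exact: FR.
    split=> // b.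
    have bE : (ctr b *m Z *m b) 0 0 = \sum_i \sum_k star (b i 0) * (Z i k * b k 0).
      rewrite -mulmxA mxE; apply: eq_bigr => i _; rewrite ctrE mxE mulr_sumr.
      by apply: eq_bigr.
    (* For e in E, j maps e^* (b^* Z b) e to the form of X at the column [j (b_i * e)], since
       [X i k] acts on [j (b_k * e)] as [Z i k]. *)
    apply: (pos_reflect hj Eid Eess).
    - by move=> e _ e0; apply: jinj; rewrite (hom0 hj).
    - by rewrite -ctrE !ctrM sZ ctrK mulmxA.
    - move=> e Ee; pose w : 'cV[D]_n := \col_i j (b i 0 * e).
      have := pX w; congr pos; rewrite bE mulr_sumr mulr_suml (hom_sum hj).
      rewrite -mulmxA mxE; apply: eq_bigr => i _; rewrite ctrE.
      rewrite [(X *m w) i 0]mxE [w i 0]mxE.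
      rewrite !mulr_sumr mulr_suml (hom_sum hj); apply: eq_bigr => k _.
      have [h _] := FR _ (SX i k) _ (Eid (b k 0) _ Ee).
      rewrite [w k 0]mxE h -(star_hom_star hj) -(star_hom_mul hj) star_mul.
      by rewrite [Z i k]mxE !mulrA.
have [h ucph hf] := env_injective hI opS opT (@subsetT _ S) ucpf.
exists h => // s a hs; rewrite hf; last by exists a.
by rewrite /= (FE _ _ hs).
Qed.

(** * Ucp maps and their multiplicative domains *)

Lemma addrBB_cancel (V : zmodType) (p u v w u' v' w' : V) :
  p + u + (v + w) - (p + u' + (v' + w')) = u - u' + (v - v') + (w - w').
Proof.
rewrite -[p + u + _]addrA -[p + u' + _]addrA opprD addrACA subrr add0r.
by rewrite opprD addrACA -[RHS]addrA; congr (_ + _); rewrite opprD addrACA.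
Qed.

Section Ucp.
Variables (R : realType) (A B : cstarType R) (f : A -> B).
Hypothesis hf : ucp setT setT f.

Lemma ucp_lin c x y : f (c *: x + y) = c *: f x + f y.
Proof. exact: (ucp_linear hf). Qed.

Lemma ucp0 : f 0 = 0.
Proof. by have := ucp_lin (-1) 0 0; rewrite scaler0 addr0 scaleN1r addNr. Qed.

Lemma ucpZ c x : f (c *: x) = c *: f x.
Proof. by have := ucp_lin c x 0; rewrite !addr0 ucp0 addr0. Qed.

Lemma ucpD x y : f (x + y) = f x + f y.
Proof. by have := ucp_lin 1 x y; rewrite !scale1r. Qed.

Lemma ucpN x : f (- x) = - f x.
Proof. by rewrite -scaleN1r ucpZ scaleN1r. Qed.

Lemma ucpB x y : f (x - y) = f x - f y.
Proof. by rewrite ucpD ucpN. Qed.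

(** Compatibility with [star] and the Schwarz inequality both come from the row (1, x). *)
Lemma ucp_rank1 n (v : 'I_n -> A) :
  fpos (\matrix_(i, j) f (star (v i) * v j)).
Proof.
have : mx_ge0 (\matrix_(i, j) (star (v i) * v j)).
  apply: fpos_mx_ge0; pose V := \row_i v i.
  have -> : \matrix_(i, j) (star (v i) * v j) = ctr V *m V.
    by apply/matrixP => i j; rewrite !mxE big_ord1 !mxE.
  exact: fpos_sqr.
move=> /(ucp_cp hf)[//|Y XY].
have -> : \matrix_(i, j) f (star (v i) * v j) = ctr Y *m Y.
  by rewrite -[RHS]XY; apply/matrixP => i j; rewrite !mxE.
exact: fpos_sqr.
Qed.

Let pair_vec (x : A) (i : 'I_2) : A := if i == ord0 then 1 else x.

Lemma ucp_star x : f (star x) = star (f x).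
Proof.
have [/matrixP/(_ ord_max ord0)] := ucp_rank1 (pair_vec x).
by rewrite !mxE /pair_vec /= star1 mul1r mulr1 => <-.
Qed.

(** The form of the matrix of the row (1, x) at the column (- f x, 1). *)
Lemma ucp_schwarz x : pos (f (star x * x) - star (f x) * f x).
Proof.
have [_ h] := ucp_rank1 (pair_vec x).
have := h (\col_i if i == ord0 then - f x else 1); congr pos.
rewrite -mulmxA mxE !big_ord_recl big_ord0 !ctrE !mxE !big_ord_recl !big_ord0 !mxE.
rewrite /pair_vec /= !addr0 !star1 !mul1r !mulr1 (ucp_one hf) ucp_star mul1r.
by rewrite starN addNr mulr0 add0r mulrN addrC.
Qed.

Lemma ucp_pos x : pos x -> pos (f x).
Proof.
move=> /pos_sqrt[y [[sy _] <- _]]; have := ucp_schwarz y; rewrite sy => h.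
by rewrite -[f _](subrK (star (f y) * f y)); apply: posD => //; exact: pos_star_mul.
Qed.

Lemma ucp_contractive x : nm (f x) <= nm x.
Proof.
rewrite -(@ler_pXn2r _ 2%N) ?nnegrE ?nm_ge0 // -!nmC.
apply: (le_trans (pos_le_nm (pos_star_mul _) (ucp_schwarz x))).
set b := star x * x.
have pb : pos b by exact: pos_star_mul.
set t := nm b.
have t0 : 0 <= t by exact: nm_ge0.
have frt : f (rsc A t) = rsc B t by rewrite /rsc /csc ucpZ (ucp_one hf).
apply: (@le_trans _ _ (nm (rsc B t))); last exact: nm_rsc1.
apply: pos_le_nm; first exact: ucp_pos.
rewrite -frt -ucpB; apply: ucp_pos.
split; first by rewrite starB star_rsc; case: pb => ->.
by exists t; rewrite opprB addrC subrK.
Qed.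

(* Schwarz for x + t c y, as t -> 0, for c = 1, -1, i and -i. *)
Lemma ucp_mul_star x y : f (star x * x) = star (f x) * f x ->
  f (star x * y) = star (f x) * f y.
Proof.
move=> fx; pose d z := f (star x * z) - star (f x) * f z.
have dpos z : pos (d z + star (d z)).
  (* By [fx] the Schwarz defect of x + t z has no term of order 0, and its term of order t is
     [d z + star (d z)]. *)
  apply: (pos_infinitesimal (b := f (star z * z) - star (f z) * f z)).
    by rewrite starD starK addrC.
  move=> t t0; have := ucp_schwarz (x + rsc A t * z); congr pos.
  have frt u : f (rsc A t * u) = rsc B t * f u by rewrite /rsc -!cscE ucpZ.
  have -> : star (d z) = f (star z * x) - star (f z) * f x.
    by rewrite /d starB -ucp_star !star_mul !starK.
  rewrite /d !mulrBr.
  rewrite !ucpD !starD !frt !star_mul !star_rsc -!rsc_comm !mulrDl !mulrDr.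
  by rewrite !mulrN !ucpD !rsc_mulCA -!mulrA !frt fx !rscMl addrBB_cancel.
have dN z : d (- z) = - d z.
  by rewrite /d mulrN !ucpN mulrN -opprD.
have dD z : d z + star (d z) = 0.
  apply: pos_antisym => //; have := dpos (- z); congr pos.
  by rewrite dN starN -opprD.
have di : d (csc A 'i%R * y) = csc B 'i%R * d y.
  by rewrite /d csc_mulCA -!cscE !ucpZ !cscE csc_mulCA mulrBr.
have h1 := dD y; have := dD (csc A 'i%R * y).
rewrite di star_mul star_csc conjCi -csc_comm cscN mulNr -mulrBr.
have -> : star (d y) = - d y by apply/eqP; rewrite -addr_eq0 addrC h1.
rewrite opprK => h2.
have h3 : d y + d y = 0.
  have := congr1 (fun z => csc B (- 'i%R) * z) h2.
  rewrite mulrA -cscM mulNr -expr2 sqrCi opprK csc1 mul1r mulr0.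
  by [].
apply/eqP; rewrite -subr_eq0 -/(d y); apply/eqP; apply: nm_eq0.
have := nm_rsc 2 (d y); rewrite (rscD B 1 1) rsc1 mulrDl mul1r h3 nm0 ger0_norm //.
lra.
Qed.

Lemma ucp_mulr x y : f (star x * x) = star (f x) * f x -> f (y * x) = f y * f x.
Proof.
move=> fx; have := congr1 (@star R B) (ucp_mul_star (star y) fx).
by rewrite -!ucp_star star_mul ucp_star !starK star_mul starK ucp_star starK.
Qed.

Lemma ucp_mull x y : f (x * star x) = f x * star (f x) -> f (x * y) = f x * f y.
Proof.
move=> fx; have := @ucp_mul_star (star x) y.
by rewrite ucp_star !starK => /(_ fx).
Qed.
End Ucp.

(** * Partial actions *)

Section UnitalPartialAction.
Variables (R : realType) (G : groupType) (B : cstarType R).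
Variables (Bg : G -> set B) (beta : G -> B -> B) (r : G -> B).
Hypothesis hb : unital_partial_action Bg beta r.

Lemma upa_mem g x : Bg g x <-> x * r g = x.
Proof.
have [_ /(_ g)[[_ rr _] ->]] := hb; split=> [[a _ <-]|h].
  by rewrite -mulrA rr.
by exists x.
Qed.

Lemma upa_central g x : r g * x = x * r g.
Proof. by have [_ /(_ g)[[_ _ ->]]] := hb. Qed.

Lemma upa_idem g : r g * r g = r g.
Proof. by have [_ /(_ g)[[_ -> _]]] := hb. Qed.

Lemma upa_star g : star (r g) = r g.
Proof. by have [_ /(_ g)[[-> _ _]]] := hb. Qed.

Lemma upa_mulr_mem g x : Bg g (x * r g).
Proof. by apply/upa_mem; rewrite -mulrA upa_idem. Qed.

Let pa : partial_action Bg beta. Proof. by case: hb. Qed.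

Lemma upa_mull_mem g x y : Bg g y -> Bg g (x * y).
Proof. by move=> /upa_mem h; apply/upa_mem; rewrite -mulrA h. Qed.

Lemma upa_beta_mem g x : Bg g^-1%g x -> Bg g (beta g x).
Proof. by have [h _ _] := pact_bij pa g; apply: h. Qed.

(** [beta g] made total by cutting with the unit of its domain: a *-endomorphism of B, not unital in
    general, whose values on A generate the orbit algebra. *)
Definition upa_act g x := beta g (x * r g^-1%g).

Lemma upa_act_mem g x : upa_act g x * r g = upa_act g x.
Proof. by apply/upa_mem; apply: upa_beta_mem; exact: upa_mulr_mem. Qed.

Lemma upa_act_hom g : star_hom (upa_act g).
Proof.
split.
- move=> c x y _ _; rewrite /upa_act mulrDl cscE -mulrA -cscE.
  by rewrite (pact_linear pa) //; exact: upa_mulr_mem.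
- move=> x y; rewrite /upa_act -(pact_mul pa); try exact: upa_mulr_mem.
  congr beta; rewrite -[RHS]mulrA [r _ * _]mulrA upa_central -[y * _ * _]mulrA.
  by rewrite upa_idem mulrA.
- move=> x; rewrite /upa_act -(pact_star pa); last exact: upa_mulr_mem.
  by rewrite star_mul upa_star upa_central.
Qed.

(** Both sides are the unit of the ideal B_(hk) [&] B_h, the image under beta_h of the ideal with
    unit r_(h^-1) r_k. *)
Lemma upa_proj_image h k :
  beta h (r h^-1%g * r k) = r (h * k)%g * r h.
Proof.
set e := beta h _.
have m1 : Bg h^-1%g (r h^-1%g * r k) by rewrite upa_central; exact: upa_mulr_mem.
have m2 : Bg k (r h^-1%g * r k) by exact: upa_mulr_mem.
have [e1 e2] : (Bg (h * k)%g `&` Bg h) e.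
  by rewrite -(pact_image pa); exists (r h^-1%g * r k).
have [z [z1 z2] zE] : (beta h @` (Bg h^-1%g `&` Bg k)) (r (h * k)%g * r h).
  rewrite (pact_image pa); split; last exact: upa_mulr_mem.
  by rewrite upa_central; exact: upa_mulr_mem.
have : r (h * k)%g * r h * e = r (h * k)%g * r h.
  rewrite -zE -(pact_mul pa) //; congr beta.
  by move/upa_mem: z1 => z1; move/upa_mem: z2 => z2; rewrite mulrA z1 z2.
move=> <-; move/upa_mem: e1 => e1; move/upa_mem: e2 => e2.
by rewrite -mulrA upa_central -mulrA upa_central e1 e2.
Qed.

(** The factor [r g] appears because beta_g beta_h only restricts beta_(gh): both sides are
    beta_(gh) (x r_(h^-1) r_((gh)^-1)). *)
Lemma upa_actM g h x : upa_act g (upa_act h x) = upa_act (g * h)%g x * r g.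
Proof.
set v := x * (r h^-1%g * r (g * h)^-1%g).
have v1 : Bg h^-1%g v by apply: upa_mull_mem; rewrite upa_central; exact: upa_mulr_mem.
have v2 : Bg (g * h)^-1%g v by apply: upa_mull_mem; exact: upa_mulr_mem.
have e1 : upa_act h x * r g^-1%g = beta h v.
  have := upa_proj_image h (g * h)^-1%g; rewrite invgM mulgA mulgV mul1g => e.
  rewrite -upa_act_mem -mulrA [r h * _]upa_central -e -invgM.
  rewrite /upa_act -(pact_mul pa); [|exact: upa_mulr_mem|].
    by rewrite /v -!mulrA [r h^-1%g * (r h^-1%g * _)]mulrA upa_idem.
  by rewrite upa_central; exact: upa_mulr_mem.
rewrite {1}/upa_act e1 (pact_comp pa) //.
have := upa_proj_image (g * h)%g h^-1%g; rewrite -mulgA mulgV mulg1 => e.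
rewrite -upa_act_mem -mulrA [r (g * h)%g * _]upa_central -e.
rewrite /upa_act -(pact_mul pa); [|exact: upa_mulr_mem|].
  rewrite /v; congr beta.
  rewrite [in RHS]upa_central -!mulrA; congr (_ * _).
  by rewrite [RHS]upa_central -mulrA upa_idem.
by rewrite upa_central; exact: upa_mulr_mem.
Qed.

End UnitalPartialAction.

(** * Supports of ideals and essential sets in the injective envelope *)

(* p is bounded by (1 - s k) p (1 - s k) for all s > 0, where k = star y * y. *)
Lemma support_annihilator (R : realType) (A I : cstarType R) (iI : A -> I)
    (J : set A) L (le : L -> L -> Prop) (e : L -> A) (p y : I) :
  star_hom iI -> increasing_approx_id J le e -> cstar_sup (range (iI \o e)) p ->
  central_projection p -> (forall l, y * iI (e l) = 0) -> y * p = 0.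
Proof.
move=> hi he [_ pub pleast] [sp pp pc] ye.
pose k := star y * y.
have sk : star k = k by rewrite star_mul starK.
have se l : star (iI (e l)) = iI (e l).
  rewrite -(star_hom_star hi); congr iI.
  by have /cstar_ge0P[] := aid_ge0 he l.
have ke l : k * iI (e l) = 0 by rewrite -mulrA ye mulr0.
have ek l : iI (e l) * k = 0.
  by rewrite -[LHS]starK star_mul se sk ke star0.
have kpE : k * p = star (y * p) * (y * p).
  by rewrite star_mul sp -mulrA pc -!mulrA pp mulrA.
have pkp : pos (k * p) by rewrite kpE; exact: pos_star_mul.
have neg : pos (- (k * p + k * p)).
  apply: (pos_infinitesimal (b := k * (k * p))).
    by rewrite starN starD; case: pkp => ->.
  move=> s s0; pose w := 1 - rsc I s * k.
  have sw : star w = w by rewrite starB star1 star_mul star_rsc sk -rsc_comm.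
  (* k kills each [iI (e l)], so conjugation by w fixes it, and w p w is another upper bound of the
     approximate identity. *)
  have : cstar_le p (w * p * w).
    apply: pleast; first by rewrite !star_mul sw sp mulrA.
    move=> _ [l _ <-] /=; apply/cstar_ge0P.
    have -> : w * p * w - iI (e l) = star w * (p - iI (e l)) * w.
      rewrite sw [w * (p - _)]mulrBr [RHS]mulrBl; congr (_ - _).
      rewrite /w mulrBl mul1r -mulrA ke mulr0 subr0.
      by rewrite mulrBr mulr1 rsc_mulCA ek mulr0 subr0.
    apply: pos_conj; apply/cstar_ge0P; apply: pub.
    by exists l.
  move/cstar_ge0P; congr pos.
  have -> : w * p * w - p = w * (w * p) - p by rewrite -mulrA pc.
  set u := rsc I s * (k * p); set v := rsc I (s * s) * _.
  have -> : w * p = p - u by rewrite /w mulrBl mul1r -mulrA.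
  have -> : w * (p - u) = p - u - (u - v).
    by rewrite /w mulrBl mul1r; congr (_ - _); rewrite mulrBr -mulrA rscMM.
  by rewrite mulrN mulrDr opprB opprD addrC !addrA addNr add0r addrAC.
apply: star_mul_eq0; rewrite -kpE; apply: pos_antisym => //.
have kp2 : k * p + k * p = 0.
  by apply: pos_antisym => //; exact: posD.
have -> : - (k * p) = k * p by apply/eqP; rewrite eq_sym -addr_eq0 kp2.
by [].
Qed.

(** In [envelope_extension] with ambient algebra I, each [iI a] is related to a and z to 0.
    Self-adjointness of z provides the half of the relation that concerns [star z]. *)
Lemma envelope_essential (R : realType) (A I : cstarType R) (iI : A -> I)
    (hI : injective_envelope iI) (E : set A) (z : I) :
  (forall a e, E e -> E (a * e)) ->
  (forall a, (forall e, E e -> a * e = 0) -> a = 0) ->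
  star z = z -> (forall e, E e -> z * iI e = 0) -> z = 0.
Proof.
move=> Eid Eess sz hz.
have hi : star_hom iI by case: (env_inclusion hI).
have [h ucph hE] := envelope_extension hI (env_inclusion hI) Eid Eess.
have hid := env_rigid hI ucph.
rewrite -[LHS]hid; last first.
  move=> a; apply: hE => e _.
  by rewrite -(star_hom_star hi) -!(star_hom_mul hi).
rewrite (hE z 0) ?(hom0 hi) // => e Ee.
by rewrite sz hz // star0 mul0r (hom0 hi).
Qed.

(** As a kills J, e_l a^* = (a e_l)^* = 0, so a^* x = lim e_l a^* x = 0 on J. Thus a^* lies in the
    annihilator, and a a^* = 0. *)
Lemma ideal_annihilator_essential (R : realType) (A : cstarType R) (J : set A) L
    (le : L -> L -> Prop) (e : L -> A) (a : A) :
  is_ideal J -> increasing_approx_id J le e ->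
  (forall x, J x \/ annihilator J x -> a * x = 0) -> a = 0.
Proof.
move=> iJ he ha.
suff as0 : annihilator J (star a).
  have := ha (star a) (or_intror as0); rewrite -{1}[a]starK => /star_mul_eq0.
  by move=> h; rewrite -[a]starK h star0.
move=> x Jx; apply: nm_small => t t0.
have Jax : J (star a * x) by exact: (ideal_mull iJ).
have nb : nbhs (star a * x) (ball (star a * x) (t%:C)%C).
  by apply: nbhsx_ballx; rewrite ltcR.
have [l _ /(_ l (aid_refl he l))] := aid_cvgl he Jax nb.
have se : star (e l) = e l by have /cstar_ge0P[] := aid_ge0 he l.
have ea : e l * star a = 0.
  rewrite -[LHS]starK star_mul starK se ha ?star0 //; left; exact: aid_in he l.
rewrite /= mulrA ea mul0r -ball_normE /= nmE ltcR subr0; exact: ltW.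
Qed.

(** * Closed subalgebras cut out by equations *)

Lemma eq_of_approx (R : realType) (A B : cstarType R) (f g : A -> B) (K : R) (x : A) :
  (forall u v, nm (f u - f v) <= K * nm (u - v)) ->
  (forall u v, nm (g u - g v) <= K * nm (u - v)) ->
  (forall e : R, 0 < e -> exists2 y, f y = g y & nm (x - y) <= e) -> f x = g x.
Proof.
move=> hf hg happ; apply/eqP; rewrite -subr_eq0; apply/eqP; apply: nm_small => e e0.
(* K may be 0, for instance when it is the norm of a fixed factor y = 0. *)
pose K1 := Num.max K 1.
have K10 : 0 < K1 by rewrite lt_max ltr01 orbT.
have [|y fgy hy] := happ (e / (2 * K1)); first by rewrite divr_gt0 // mulr_gt0.
have KK : K * nm (x - y) <= K1 * nm (x - y).
  by rewrite ler_wpM2r ?nm_ge0 // le_max lexx.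
have hK : K1 * nm (x - y) <= e / 2.
  have -> : e / 2 = K1 * (e / (2 * K1)) by field; rewrite gt_eqF.
  by rewrite ler_wpM2l // ltW.
have := nmB (f x - f y) (g x - g y).
rewrite opprB fgy addrA subrK; have := hf x y; have := hg x y; rewrite fgy; lra.
Qed.

Lemma equalizer_subalgebra (R : realType) (A B : cstarType R) (f g : A -> B) :
  star_hom f -> star_hom g -> is_cstar_subalgebra [set x | f x = g x].
Proof.
move=> hf hg; split.
- split=> [|c x y /= fx fy]; first by rewrite /= !hom0.
  by rewrite !hom_lin // fx fy.
- apply: nm_closed => x; apply: (@eq_of_approx _ _ _ _ _ 1) => u v;
    by rewrite mul1r -homB // hom_contractive.
- by move=> x y /= fx fy; rewrite !star_hom_mul // fx fy.
- by move=> x /= fx; rewrite !star_hom_star // fx.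
Qed.

Lemma star_hom_comp (R : realType) (A B C : cstarType R) (f : A -> B) (g : B -> C) :
  star_hom f -> star_hom g -> star_hom (g \o f).
Proof.
move=> hf hg; split.
- by move=> c x y _ _ /=; rewrite !hom_lin.
- by move=> x y /=; rewrite !star_hom_mul.
- by move=> x /=; rewrite !star_hom_star.
Qed.

Lemma preimage_subalgebra (R : realType) (A B : cstarType R) (f : A -> B) (S : set B) :
  star_hom f -> is_cstar_subalgebra S -> is_cstar_subalgebra (f @^-1` S).
Proof.
move=> hf [[S0 Slin] Scl SM Sst]; split.
- split=> [|c x y /= Sx Sy]; first by rewrite /preimage /= hom0.
  by rewrite hom_lin //; exact: Slin.
- apply: nm_closed => x happ; apply: (closed_nm Scl) => e e0.
  have [y Sy hy] := happ e e0; exists (f y) => //.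
  by rewrite -homB // (le_trans (hom_contractive hf _)).
- by move=> x y /= Sx Sy; rewrite /preimage /= star_hom_mul //; exact: SM.
- by move=> x /= Sx; rewrite /preimage /= star_hom_star //; exact: Sst.
Qed.

Lemma mult_domain_subalgebra (R : realType) (A B : cstarType R) (f : A -> B) :
  ucp setT setT f ->
  is_cstar_subalgebra [set x | forall y, f (x * y) = f x * f y /\
                                         f (y * x) = f y * f x].
Proof.
move=> hf.
have dist (L : A -> A) (M : A -> B) K : {morph L : x y / x - y} ->
    (forall x, nm (L x) <= K * nm x) ->
    forall u v, nm (f (L u) - f (L v)) <= K * nm (u - v).
  move=> LB hL u v; rewrite -ucpB // -LB.
  by apply: le_trans (ucp_contractive hf _) _.
split.
- split=> [y|c x z hx hz y] /=.
    by rewrite ucp0 // !mul0r !mulr0 ucp0.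
  have [hx1 hx2] := hx y; have [hz1 hz2] := hz y.
  have fc u : f (csc A c * u) = csc B c * f u by rewrite -!cscE ucpZ.
  rewrite cscE; split.
    by rewrite mulrDl -mulrA !(ucpD hf) !fc hx1 hz1 mulrDl mulrA.
  by rewrite mulrDr csc_mulCA !(ucpD hf) mulrDr !fc hx2 hz2 csc_mulCA.
- apply: nm_closed => x happ y; split.
  + apply: (@eq_of_approx _ _ _ (fun x => f (x * y)) (fun x => f x * f y) (nm y)).
    * move=> u v; rewrite -ucpB // -mulrBl (le_trans (ucp_contractive hf _)) //.
      by rewrite mulrC nmM.
    * move=> u v; rewrite -mulrBl -ucpB // (le_trans (nmM _ _)) // mulrC.
      by rewrite ler_pM ?nm_ge0 ?ucp_contractive.
    * by move=> e e0; have [z /(_ y)[? _] ?] := happ e e0; exists z.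
  + apply: (@eq_of_approx _ _ _ (fun x => f (y * x)) (fun x => f y * f x) (nm y)).
    * by move=> u v; rewrite -ucpB // -mulrBr (le_trans (ucp_contractive hf _)) // nmM.
    * move=> u v; rewrite -mulrBr -ucpB // (le_trans (nmM _ _)) //.
      by rewrite ler_pM ?nm_ge0 ?ucp_contractive.
    * by move=> e e0; have [z /(_ y)[_ ?] ?] := happ e e0; exists z.
- move=> x z hx hz y /=; split.
    by rewrite -mulrA (hx _).1 (hz _).1 (hx _).1 mulrA.
  by rewrite mulrA (hz _).2 (hx _).2 (hz _).2 mulrA.
- move=> x hx y /=; have [h1 h2] := hx (star y).
  have e u v : f (u * v) = f u * f v -> f (star v * star u) = f (star v) * f (star u).
    by move=> h; rewrite -star_mul !(ucp_star hf) h star_mul.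
  by have := e _ _ h1; have := e _ _ h2; rewrite starK.
Qed.

(** * Generators of the orbit algebra and the morphism *)

(** Multiplied by an element of i(A_g), a generator falls into i(A) and is determined by alpha; this
    makes generators of B and of the envelope comparable. *)
Lemma equivariant_act (R : realType) (G : groupType) (A C : cstarType R)
    (Ag : G -> set A) (alpha : G -> A -> A)
    (Cg : G -> set C) (gamma : G -> C -> C) (p : G -> C) (i : A -> C) g a d :
  unital_partial_action Cg gamma p -> partial_action Ag alpha ->
  equivariant_inclusion Ag alpha Cg gamma i -> Ag g^-1%g d ->
  upa_act gamma p g (i a) * i (alpha g d) = i (alpha g (a * d)).
Proof.
move=> hC hA [[hi _] isub ieq] dA.
have id_in : Cg g^-1%g (i d) by apply: isub; exists d.
rewrite -ieq // -ieq; last exact: (ideal_mull (pact_ideal hA _)).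
rewrite /upa_act -(pact_mul hC.1) //; last exact: upa_mulr_mem hC _ _.
rewrite -mulrA (upa_central hC) (star_hom_mul hi).
by move/(upa_mem hC): id_in => ->.
Qed.

Lemma envelope_extension_id (R : realType) (A I : cstarType R) (iI : A -> I)
    (hI : injective_envelope iI) (B : cstarType R) (iB : A -> B) :
  cstar_inclusion iB ->
  exists2 phi : B -> I, ucp setT setT phi & forall a, phi (iB a) = iI a.
Proof.
move=> hB; have [hiB _] := hB.
have [//|a /(_ 1 Logic.I)|phi ucp_phi hphi] :=
  envelope_extension hI hB (E := setT).
  by rewrite mulr1.
exists phi => // a; apply: hphi => e _.
by rewrite -(star_hom_star hiB) -!(star_hom_mul hiB).
Qed.

Lemma Orb_full_ind (R : realType) (G : groupType) (A B : cstarType R)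
    (iB : A -> B) (beta : G -> B -> B) (r : G -> B) (S : set B) :
  Orb iB beta r = setT -> is_cstar_subalgebra S ->
  (forall g a, S (upa_act beta r g (iB a))) -> forall x, S x.
Proof.
move=> hOrb hS hgen x.
have : Orb iB beta r x by rewrite hOrb.
by apply: smallest_sub => // _ [a [g ->]]; exact: hgen.
Qed.

Theorem lemma5p7 (R : realType) (G : groupType)
    (A : cstarType R) (Ag : G -> set A) (alpha : G -> A -> A)
    (halpha : partial_action Ag alpha)
    (B : cstarType R) (Bg : G -> set B) (beta : G -> B -> B) (r : G -> B)
    (hbeta : unital_partial_action Bg beta r)
    (iB : A -> B) (hiB : equivariant_inclusion Ag alpha Bg beta iB)
    (hOrb : Orb iB beta r = setT)
    (hann : forall g : G,
      [set r g * iB a | a in annihilator (Ag g)] = [set 0])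
    (I : cstarType R) (iI : A -> I) (hI : injective_envelope iI)
    (Ig : G -> set I) (gamma : G -> I -> I) (p : G -> I)
    (hgamma : envelope_action Ag alpha iI Ig gamma p) :
  exists Psi : B -> I,
    G_morphism Bg beta r (Orb iI gamma p) gamma p Psi /\
    (forall a : A, Psi (iB a) = iI a).
Proof.
have [hupa hsupp hiI] := hgamma.
have [hincB subB _] := hiB; have [hincI subI _] := hiI.
have [homB _] := hincB; have [homI _] := hincI.
have [phi ucp_phi phi_iB] := envelope_extension_id hI hincB.
have phi_mulr a y : phi (y * iB a) = phi y * iI a.
  rewrite -phi_iB; apply: (ucp_mulr ucp_phi).
  rewrite -(star_hom_star homB) -(star_hom_mul homB) !phi_iB.
  by rewrite (star_hom_mul homI) (star_hom_star homI).
have supp_ann g y : (forall a, Ag g a -> y * iI a = 0) -> y * p g = 0.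
  move=> hy; have [L [le [e [he hsup]]]] := hsupp g.
  apply: (support_annihilator homI he hsup); first by case: hupa => _ /(_ g)[].
  by move=> l; apply: hy; exact: aid_in he l.
have phi_r g : phi (r g) = p g.
  apply/eqP; rewrite -subr_eq0; apply/eqP.
  have [L [le [e [he hsup]]]] := hsupp g.
  (* A union can stand for the sum, since E need only be stable under left multiplication. *)
  apply: (envelope_essential hI (E := Ag g `|` annihilator (Ag g))).
  - move=> a x [Ax|Nx]; [left|right]; first exact: (ideal_mull (pact_ideal halpha g)).
    by move=> z Az; rewrite -mulrA Nx // mulr0.
  - by move=> a; apply: ideal_annihilator_essential (pact_ideal halpha g) he.
  - by rewrite starB -(ucp_star ucp_phi) (upa_star hbeta) (upa_star hupa).
  - move=> x [Ax|Nx]; rewrite mulrBl -phi_mulr (upa_central hupa).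
      rewrite (upa_central hbeta).
      have /(upa_mem hbeta) -> : Bg g (iB x) by apply: subB; exists x.
      have /(upa_mem hupa) -> : Ig g (iI x) by apply: subI; exists x.
      by rewrite phi_iB subrr.
    have -> : r g * iB x = 0.
      suff : [set r g * iB a | a in annihilator (Ag g)] (r g * iB x).
        by rewrite hann.
      by exists x.
    rewrite (ucp0 ucp_phi) sub0r supp_ann ?oppr0 // => a Aa.
    by rewrite -(star_hom_mul homI) Nx // (hom0 homI).
have phi_mul_r g y : phi (y * r g) = phi y * p g.
  rewrite -phi_r; apply: (ucp_mulr ucp_phi).
  by rewrite (upa_star hbeta) (upa_idem hbeta) !phi_r (upa_star hupa) (upa_idem hupa).
have phi_gen g a : phi (upa_act beta r g (iB a)) = upa_act gamma p g (iI a).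
  apply/eqP; rewrite -subr_eq0; apply/eqP.
  (* Both terms are cut by [p g], so it is enough that their difference kills iI(A_g), whose
     elements come from some [alpha g d]. *)
  rewrite -[upa_act beta r g _](upa_act_mem hbeta) phi_mul_r.
  rewrite -[upa_act gamma p g _](upa_act_mem hupa) -mulrBl.
  apply: supp_ann => x Ax.
  have [_ _ /(_ x Ax)[d Ad <-]] := pact_bij halpha g.
  rewrite mulrBl -phi_mulr (equivariant_act _ hbeta halpha hiB Ad) phi_iB.
  by rewrite (equivariant_act _ hupa halpha hiI Ad) subrr.
(* [star b * b] is the generator attached to [star a * a], so [phi_gen] computes its image too. *)
have phi_sqr g a : let b := upa_act beta r g (iB a) in
    phi (star b * b) = star (phi b) * phi b.
  rewrite /= phi_gen -(star_hom_star (upa_act_hom hbeta g)).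
  rewrite -(star_hom_mul (upa_act_hom hbeta g)).
  rewrite -(star_hom_star homB) -(star_hom_mul homB) phi_gen.
  rewrite (star_hom_mul homI) (star_hom_star homI).
  by rewrite (star_hom_mul (upa_act_hom hupa g)) (star_hom_star (upa_act_hom hupa g)).
have phiM x y : phi (x * y) = phi x * phi y.
  have [] // := Orb_full_ind hOrb (mult_domain_subalgebra ucp_phi) _ x y.
  move=> g a z; split; last exact: (ucp_mulr ucp_phi).
  apply: (ucp_mull ucp_phi).
  (* The adjoint of a generator is a generator, which gives the condition on [b * star b]. *)
  have := phi_sqr g (star a).
  rewrite /= (star_hom_star homB) (star_hom_star (upa_act_hom hbeta g)) !starK.
  by rewrite (ucp_star ucp_phi) starK.
have phi_hom : star_hom phi.
  by split=> //; [move=> c x y _ _; exact: (ucp_lin ucp_phi)|exact: (ucp_star ucp_phi)].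
have phi_act g x : phi (upa_act beta r g x) = upa_act gamma p g (phi x).
  apply: (Orb_full_ind hOrb (equalizer_subalgebra
    (star_hom_comp (upa_act_hom hbeta g) phi_hom)
    (star_hom_comp phi_hom (upa_act_hom hupa g)))) => h a /=.
  (* Acting by g on the generator at h gives the generator at g h cut by [r g], on which phi is
     known. *)
  by rewrite (upa_actM hbeta) phi_mul_r !phi_gen (upa_actM hupa).
exists phi; split=> //; split=> //.
- split; [|exact: ucp_linear ucp_phi|exact: ucp_one ucp_phi|exact: ucp_cp ucp_phi].
  move=> x _ S [hS hgen].
  apply: (Orb_full_ind hOrb (preimage_subalgebra phi_hom hS)) => g a.
  by apply: hgen; exists a, g; rewrite phi_gen.
- move=> g x /(upa_mem hbeta) xr.
  have := phi_act g x; rewrite /upa_act xr => ->.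
  by rewrite -phi_mul_r xr.
Qed.
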